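(* Let $G$ and $\Gamma$ be countable groups. If $G$ and $\Gamma$ are measure equivalent and $\Gamma \in \mathcal{S}$, then $G \in \mathcal{S}$.
   Context: Class $\mathcal{S}$: A countable (discrete) group $G$ is said to be in $\mathcal{S}$ if the left-times-right translation action of $G \times G$ on $\beta G \cap G^c$ is amenable. Here $\beta G\cap G^c$ is the Gelfand spectrum of the commutative $C^*$-algebra $\ell_\infty G / c_0 G$, and the action is the one induced by $((s,t)\cdot\phi)(x) = \phi(s^{-1} x t)$ for $\phi \in \ell_\infty G$, $s,t,x\in G$. A continuous action of a discrete group $\Lambda$ on a compact Hausdorff space $Z$ is (topologically) amenable if there is a net of continuous maps $m_i \colon Z \to \mathrm{Prob}(\Lambda) \subset \ell_1(\Lambda)$ such that $\lim_i \sup_{z \in Z} \| s \cdot m_i(z) - m_i(s z)\|_1 = 0$ for every $s \in \Lambda$. Measure equivalence: Countable groups $G$ and $\Gamma$ are measure equivalent if there exist a standard ($\sigma$-finite, nonzero) measure space $(\Sigma,\nu)$, a measure preserving action of $G \times \Gamma$ on $\Sigma$, and measurable subsets $X, Y \subset \Sigma$ such that (up to null sets) $\Sigma = \bigsqcup_{\gamma \in \Gamma} \gamma(X) = \bigsqcup_{g \in G} g(Y)$, $\nu(X) < \infty$ and $\nu(Y) < \infty$. *)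

(* Defs.v *)
From HB Require Import structures.
From mathcomp Require Import all_boot all_order all_algebra.
From mathcomp Require Import ring_quotient complex.
From mathcomp Require Import all_classical all_reals all_analysis.

Set Implicit Arguments.
Unset Strict Implicit.
Unset Printing Implicit Defensive.

Import Order.TTheory GRing.Theory Num.Theory.
Import numFieldNormedType.Exports.

Local Open Scope classical_set_scope.
Local Open Scope ring_scope.
Local Open Scope quotient_scope.
Local Open Scope complex_scope.

Section Linfty.
Variables (R : realType) (G : groupType).
Local Notation C := R[i].

Definition bounded_pred : {pred G -> C^o} :=
  fun f => `[< exists M : C, forall x, `|f x| <= M >].

Lemma bounded_pred_subring : subring_closed bounded_pred.
Proof.
split.
- by apply/asboolP; exists 1 => x; rewrite normr1.
- move=> f g /asboolP[M fM] /asboolP[N gN]; apply/asboolP; exists (M + N) => x.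
  by rewrite (le_trans (ler_normB _ _))// lerD.
- move=> f g /asboolP[M fM] /asboolP[N gN]; apply/asboolP; exists (M * N) => x.
  by rewrite normrM ler_pM.
Qed.

Lemma bounded_pred_scaler : GRing.scaler_closed bounded_pred.
Proof.
move=> c f /asboolP[M fM]; apply/asboolP; exists (`|c| * M) => x.
by rewrite normrM ler_wpM2l.
Qed.

HB.instance Definition _ :=
  GRing.isSubringClosed.Build (G -> C^o) bounded_pred bounded_pred_subring.
HB.instance Definition _ :=
  GRing.isScaleClosed.Build C (G -> C^o) bounded_pred bounded_pred_scaler.

Record linfty := Linfty {
  linfty_fun :> G -> C^o ;
  linfty_bounded : linfty_fun \in bounded_pred }.

HB.instance Definition _ := [isSub for linfty_fun].
HB.instance Definition _ := [Choice of linfty by <:].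
HB.instance Definition _ := GRing.SubChoice_isSubComPzRing.Build
  (G -> C^o) bounded_pred linfty (subringClosedP _).
HB.instance Definition _ := [SubZmodule_isSubLmodule of linfty by <:].

Lemma linfty_boundP (phi : linfty) : exists M : C, forall x, `|phi x| <= M.
Proof. by case: phi => f fb; move/asboolP: (fb). Qed.

Definition c0_pred : {pred linfty} := fun phi =>
  `[< forall eps : C, 0 < eps -> finite_set [set x : G | eps <= `|phi x|] >].

Lemma c0P (phi : linfty) : reflect
  (forall eps : C, 0 < eps -> finite_set [set x : G | eps <= `|phi x|])
  (phi \in c0_pred).
Proof. exact: asboolP. Qed.

Lemma c0_pred_zmod : zmod_closed c0_pred.
Proof.
split.
  apply/c0P => eps e0; rewrite (_ : [set _ | _] = set0) ?finite_set0//.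
  by apply/seteqP; split => // x /=; rewrite normr0 lt_geF.
move=> f g /c0P f0 /c0P g0; apply/c0P => eps e0.
have e2 : 0 < eps / 2 by rewrite divr_gt0.
apply: (@sub_finite_set _ _ ([set x : G | eps / 2 <= `|f x|] `|`
  [set x : G | eps / 2 <= `|g x|])); last first.
  by rewrite finite_setU; split; [exact: f0|exact: g0].
move=> x /= ex; apply/orP; apply: contraTT ex.
rewrite negb_or -!real_ltNge ?normr_real ?gtr0_real// => /andP[fx gx].
by rewrite (le_lt_trans (ler_normB _ _))// (splitr eps) ltrD.
Qed.

Lemma c0_mulr (a f : linfty) : f \in c0_pred -> a * f \in c0_pred.
Proof.
move=> /c0P f0; apply/c0P => eps e0.
have [M aM] := linfty_boundP a.
have M0 : 0 <= M by exact: le_trans (normr_ge0 _) (aM 1%g).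
have M1 : 0 < M + 1 by rewrite ltr_wpDl.
apply: sub_finite_set (f0 (eps / (M + 1)) _); last by rewrite divr_gt0.
move=> x /= ex; rewrite ler_pdivrMr// mulrC (le_trans ex)// normrM.
by rewrite ler_wpM2r// (le_trans (aM x))// lerDl.
Qed.

Lemma linfty_scaleE (c : C) (f : linfty) : c *: f = (c *: (1 : linfty)) * f.
Proof.
by apply/val_inj/funext => x; rewrite -[RHS]/((c * 1) * f x) mulr1.
Qed.

Lemma c0_scaler (c : C) (f : linfty) : f \in c0_pred -> c *: f \in c0_pred.
Proof. by rewrite linfty_scaleE; exact: c0_mulr. Qed.

HB.instance Definition _ :=
  GRing.isZmodClosed.Build linfty c0_pred c0_pred_zmod.

(* [ring_quotient] only gives a ring structure to quotients of nontrivial rings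
   by proper ideals, and c0 is everything when G is finite; hence the ring and
   C-module structures built here on top of the Z-module quotient. *)
Definition linfty_mod_c0 := Quotient.quot c0_pred.

HB.instance Definition _ := GRing.Zmodule.on linfty_mod_c0.

Local Notation Q := linfty_mod_c0.
Definition qclass (f : linfty) : Q := \pi_(Quotient.quot c0_pred) f.
Definition qrepr (a : Q) : linfty := repr (a : Quotient.quot c0_pred).

Lemma qclass_eq (f g : linfty) : qclass f = qclass g <-> f - g \in c0_pred.
Proof. by rewrite Quotient.idealrBE; split => [/eqP|/eqP]. Qed.

Lemma qreprK (a : Q) : qclass (qrepr a) = a.
Proof. exact: reprK. Qed.

Lemma qclassK (f : linfty) : qrepr (qclass f) - f \in c0_pred.
Proof. by apply/qclass_eq; rewrite qreprK. Qed.

Lemma qclassD (f g : linfty) : qclass (f + g) = qclass f + qclass g.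
Proof. exact: (Quotient.pi_add c0_pred). Qed.

Definition qone : Q := qclass 1.
Definition qmul (a b : Q) : Q := qclass (qrepr a * qrepr b).
Definition qscale (c : C) (a : Q) : Q := qclass (c *: qrepr a).

Lemma qclass_mul (f g : linfty) : qclass (f * g) = qmul (qclass f) (qclass g).
Proof.
apply/esym/qclass_eq; set a := qrepr _; set b := qrepr _.
rewrite (_ : _ - _ = a * (b - g) + g * (a - f)).
  by rewrite rpredD// c0_mulr// qclassK.
by rewrite !mulrBr [g * a]mulrC [g * f]mulrC addrA subrK.
Qed.

Lemma qclass_scale c (f : linfty) : qclass (c *: f) = qscale c (qclass f).
Proof. by apply/esym/qclass_eq; rewrite -scalerBr c0_scaler// qclassK. Qed.

Lemma qmulA : associative qmul.
Proof.
by move=> a b d; rewrite -[a]qreprK -[b]qreprK -[d]qreprK -!qclass_mul mulrA.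
Qed.

Lemma qmulC : commutative qmul.
Proof. by move=> a b; rewrite /qmul mulrC. Qed.

Lemma qmul1 : left_id qone qmul.
Proof. by move=> a; rewrite -[a]qreprK -qclass_mul mul1r. Qed.

Lemma qmulDl : left_distributive qmul +%R.
Proof.
move=> a b d; rewrite -[a]qreprK -[b]qreprK -[d]qreprK.
by rewrite -qclassD -!qclass_mul -qclassD mulrDl.
Qed.

HB.instance Definition _ :=
  GRing.Zmodule_isComPzRing.Build Q qmulA qmulC qmul1 qmulDl.

Lemma qscaleA c e (a : Q) : qscale c (qscale e a) = qscale (c * e) a.
Proof. by rewrite -[a]qreprK -!qclass_scale scalerA. Qed.

Lemma qscale1 : left_id 1 qscale.
Proof. by move=> a; rewrite /qscale scale1r qreprK. Qed.

Lemma qscaleDr : right_distributive qscale +%R.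
Proof.
move=> c a b; rewrite -[a]qreprK -[b]qreprK.
by rewrite -qclassD -!qclass_scale -qclassD scalerDr.
Qed.

Lemma qscaleDl (a : Q) : {morph qscale^~ a : c e / c + e}.
Proof. by move=> c e; rewrite -[a]qreprK -!qclass_scale -qclassD scalerDl. Qed.

HB.instance Definition _ := GRing.Zmodule_isLmodule.Build C Q
  qscaleA qscale1 qscaleDr qscaleDl.

Lemma qclassM (f g : linfty) : qclass (f * g) = qclass f * qclass g.
Proof. exact: qclass_mul. Qed.

Lemma qclassZ (c : C) (f : linfty) : qclass (c *: f) = c *: qclass f.
Proof. exact: qclass_scale. Qed.

Lemma translate_bounded (st : G * G) (phi : linfty) :
  (fun x : G => phi (st.1^-1 * x * st.2)%g) \in bounded_pred.
Proof.
by have [M phiM] := linfty_boundP phi; apply/asboolP; exists M.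
Qed.

Definition translate (st : G * G) (phi : linfty) : linfty :=
  Linfty (translate_bounded st phi).

Lemma translate_c0 st phi : phi \in c0_pred -> translate st phi \in c0_pred.
Proof.
move=> /c0P phi0; apply/c0P => eps e0.
have := finite_image (fun x => st.1 * x * st.2^-1)%g (phi0 _ e0).
apply: sub_finite_set => x /= ex.
by exists (st.1^-1 * x * st.2)%g => //; rewrite !mulgA mulgK mulgV mul1g.
Qed.

Definition qtranslate (st : G * G) (a : Q) : Q :=
  qclass (translate st (qrepr a)).

Lemma qtranslateE st phi :
  qtranslate st (qclass phi) = qclass (translate st phi).
Proof.
apply/qclass_eq; rewrite (_ : _ - _ = translate st (qrepr (qclass phi) - phi)).
  by rewrite translate_c0// qclassK.
exact/val_inj.
Qed.

(* Characters of a C*-algebra: nonzero multiplicative linear functionals;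
   their continuity is automatic. *)
Definition is_character (chi : Q -> C^o) : Prop :=
  [/\ forall a b, chi (a + b) = chi a + chi b,
      forall (c : C) a, chi (c *: a) = c * chi a,
      forall a b, chi (a * b) = chi a * chi b
    & exists a, chi a != 0].

Definition characters : set {ptws Q -> C^o} := [set chi | is_character chi].

(* The Gelfand spectrum of linfty / c0, in the weak-* topology, i.e. pointwise
   convergence on linfty / c0.  It is empty exactly when G is finite. *)
Definition corona : topologicalType := set_type characters.

Definition corona_char (chi : corona) : Q -> C^o := set_val chi.

Lemma corona_act_subproof (st : G * G) (chi : corona) :
  (corona_char chi \o qtranslate st^-1%g) \in characters.
Proof.
apply/mem_set; rewrite /corona_char.
have [chiD chiZ chiM [a chia]] := set_mem (valP chi).
split => /=.
- move=> b d; rewrite -[b]qreprK -[d]qreprK -qclassD !qtranslateE -chiD.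
  by rewrite -qclassD; congr (set_val chi (qclass _)); exact/val_inj.
- move=> c b; rewrite -[b]qreprK -qclassZ !qtranslateE -chiZ.
  by rewrite -qclassZ; congr (set_val chi (qclass _)); exact/val_inj.
- move=> b d; rewrite -[b]qreprK -[d]qreprK -qclassM !qtranslateE -chiM.
  by rewrite -qclassM; congr (set_val chi (qclass _)); exact/val_inj.
- exists (qtranslate st a); rewrite /= (_ : qtranslate _ _ = a)//.
  rewrite -[a]qreprK !qtranslateE; congr qclass; apply/val_inj/funext => x /=.
  by rewrite invgK !mulgA mulVg mul1g mulgVK.
Qed.

(* The action dual to [qtranslate]: evaluation at x is sent by (s, t) to
   evaluation at s x t^-1. *)
Definition corona_act (st : G * G) (chi : corona) : corona :=
  exist (fun f => f \in characters) _ (corona_act_subproof st chi).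

End Linfty.

Definition is_action (L : groupType) (Z : Type) (act : L -> Z -> Z) : Prop :=
  (forall z, act 1%g z = z) /\
  (forall s t z, act (s * t)%g z = act s (act t z)).

Lemma corona_actP (R : realType) (G : groupType) :
  is_action (@corona_act R G).
Proof.
split=> [chi|st uv chi]; apply/val_inj/funext => a /=.
  congr (corona_char chi _); rewrite -[a]qreprK qtranslateE.
  by congr qclass; apply/val_inj/funext => x /=; rewrite !invg1 mul1g mulg1.
rewrite /corona_char/=; congr (set_val chi _).
rewrite -[a]qreprK !qtranslateE; congr qclass; apply/val_inj/funext => x /=.
by rewrite !invgK !invgM !mulgA.
Qed.

Lemma ptws_continuous (X V : topologicalType) (U : choiceType)
    (f : X -> {ptws U -> V}) :
  (forall a, continuous (fun x => f x a)) -> continuous f.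
Proof.
move=> fc x; apply/cvg_sup => a; move: x.
exact: (@continuous_comp_initial _ _ _ (fun g : U -> V => g a) f (fc a)).
Qed.

Lemma corona_eval_continuous (R : realType) (G : groupType)
    (a : linfty_mod_c0 R G) :
  continuous (fun chi : corona R G => corona_char chi a).
Proof.
have c1 : continuous (set_val : corona R G -> {ptws linfty_mod_c0 R G -> R[i]^o}).
  exact: initial_continuous.
have c2 := @proj_continuous (linfty_mod_c0 R G) (fun=> R[i]^o) a.
by move=> chi; apply: continuous_comp (c1 chi) (c2 _).
Qed.

Lemma corona_act_continuous (R : realType) (G : groupType) (st : G * G) :
  continuous (@corona_act R G st).
Proof.
apply: continuous_comp_initial; apply: ptws_continuous => a.
exact: corona_eval_continuous.
Qed.

Section Amenable.
Variable R : realType.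

Definition l1norm (L : choiceType) (f : L -> R) : R :=
  fine (\esum_(x in [set: L]) `|f x|%:E).

Definition Prob (L : choiceType) : set (L -> R) :=
  [set p | (forall x, 0 <= p x) /\ (\esum_(x in [set: L]) (p x)%:E = 1)%E].

Definition directed_order (I : Type) (le : I -> I -> Prop) : Prop :=
  [/\ inhabited I, forall i, le i i,
      forall i j k, le i j -> le j k -> le i k
    & forall i j, exists k, le i k /\ le j k].

(* All norms below are norms of differences of elements of Prob(L), so they are
   at most 2 and [fine] and [sup] do not meet their junk values; for Z empty,
   [sup set0 = 0] is the supremum in [0, 2]. *)
Definition amenable_action (L : groupType) (Z : topologicalType)
    (act : L -> Z -> Z) : Prop :=
  exists (I : Type) (le : I -> I -> Prop) (m : I -> Z -> L -> R),
    [/\ directed_order le,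
        forall i z, Prob (m i z),
        forall i z0, l1norm (m i z \- m i z0) @[z --> z0] --> (0 : R)
      & forall s : L,
          sup [set l1norm (fun x => m i z (s^-1 * x)%g - m i (act s z) x)
              | z in [set: Z]] @[i --> filter_from [set: I] le] --> (0 : R)].

End Amenable.

Definition classS (R : realType) (G : groupType) : Prop :=
  amenable_action R (@corona_act R G).

Section MeasureEquivalence.
Variable R : realType.

Definition standard_borel d (T : measurableType d) : Prop :=
  exists (P : completePseudoMetricType R) (f : T -> P),
    [/\ hausdorff_space P,
        exists D : set P, countable D /\ dense D,
        bijective f
      & forall A : set T, measurable A <-> <<s @open P >> (f @` A)].

(* T is the disjoint union of the translates of X, up to null sets. *)
Definition ae_tiling d (T : measurableType d) (mu : {measure set T -> \bar R})
    (L : groupType) (act : L -> T -> T) (X : set T) : Prop :=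
  mu.-negligible (~` \bigcup_s (act s @` X)) /\
  (forall s t, s <> t -> mu.-negligible (act s @` X `&` act t @` X)).

Definition measure_equivalent (G Gam : groupType) : Prop :=
  exists (d : measure_display) (T : measurableType d)
         (nu : {measure set T -> \bar R}) (act : G * Gam -> T -> T)
         (X Y : set T),
    [/\ [/\ standard_borel T, sigma_finite [set: T] nu & nu [set: T] != 0%E],
        [/\ is_action act,
            forall s, measurable_fun [set: T] (act s)
          & forall s A, measurable A -> nu (act s @^-1` A) = nu A],
        [/\ measurable X, (nu X < +oo)%E
          & ae_tiling nu (fun c => act (1%g, c)) X]
      & [/\ measurable Y, (nu Y < +oo)%E
          & ae_tiling nu (fun g => act (g, 1%g)) Y]].

End MeasureEquivalence.

(* Main.v *)
(* Write approx_equivariant G for: for every finite set E of pairs (s, t) and every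
   e > 0 there is a map m from G to the probability measures on a fixed finite
   subset of G x G such that (s, t) m(x) and m(s x t^-1) are e-close in l1 for all
   (s, t) in E and all but finitely many x.  This is equivalent to membership in
   the class S: characters of linfty / c0 are limits along nonprincipal
   ultrafilters, so one extends m to the corona coordinatewise, and conversely an
   equivariant map on the corona is, by compactness, approximated by finitely
   many constants on a finite partition of G.

   Given a coupling, let c and h be the equivariant maps to Gam and G defined by
   the two tilings, and X = {c = 1}.  Put alpha(g, x) = c(g x), theta_g(x) =
   alpha(g, x)^-1 g x (a measure preserving map of X) and u_k(x) = h(k^-1 x).
   Push m(alpha(g, x)^-1) forward along (k, k') |-> (u_k(theta_g x), u_k'(x)) and
   average over x in X to get a measure M(g) on G x G.  The cocycle identities
   turn the approximate Gam x Gam-equivariance of m into that of M, except on a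
   set of small measure: as g tends to infinity, alpha(g, x) leaves finite sets
   in measure, because g = u_1(theta_g x) u_alpha(g, x)(x)^-1 and both factors are
   tight. *)

Require Import Defs.
From mathcomp Require Import all_boot all_order all_algebra.
From mathcomp Require Import complex finmap lra.
From mathcomp Require Import all_classical all_reals all_analysis.
From mathcomp Require Import measurable_realfun.

Set Implicit Arguments.
Unset Strict Implicit.
Unset Printing Implicit Defensive.

Import Order.TTheory GRing.Theory Num.Theory.
Import numFieldNormedType.Exports.

Local Open Scope classical_set_scope.
Local Open Scope ring_scope.
Local Open Scope complex_scope.

(** * Finitely supported probability measures *)

Section FiniteProb.
Variables (R : realType).
Implicit Types (e : R).

(** The bound is put on finite partial sums, so that it makes sense without summability and without
    the default value of [fine]. *)
Definition l1le (L : choiceType) (f g : L -> R) e :=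
  forall s : seq L, uniq s -> \sum_(p <- s) `|f p - g p| <= e.

Definition fprob (L : choiceType) (F : seq L) (v : L -> R) :=
  [/\ forall p, 0 <= v p, forall p, p \notin F -> v p = 0
    & \sum_(p <- undup F) v p = 1].

Definition lact (L : groupType) (s : L) (f : L -> R) : L -> R :=
  fun p => f (s^-1 * p)%g.

Section Choice.
Variable L : choiceType.
Implicit Types (f g h v w : L -> R) (F s : seq L).

Lemma l1le_sym f g e : l1le f g e -> l1le g f e.
Proof.
by move=> fg s us; under eq_bigr do rewrite distrC; exact: fg.
Qed.

Lemma l1le_trans g f h e1 e2 : l1le f g e1 -> l1le g h e2 -> l1le f h (e1 + e2).
Proof.
move=> fg gh s us; apply: le_trans (lerD (fg s us) (gh s us)).
rewrite -big_split/=; apply: ler_sum => p _; exact: ler_distD.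
Qed.

(** A uniform bound on the partial sums makes the infinite sum finite, so [fine] returns its true
    value. *)
Lemma l1le_l1norm f g e : l1le f g e -> l1norm (f \- g) <= e.
Proof.
move=> fg; have e0 : 0 <= e by have := fg [::] isT; rewrite big_nil.
have le_e : (\esum_(x in [set: L]) `|(f \- g) x|%:E <= e%:E)%E.
  apply: ge_ereal_sup => _ [A [finA _] <-].
  by rewrite fsbig_finite//= sumEFin lee_fin fg// fset_uniq.
rewrite -lee_fin fineK// ge0_fin_numE.
  exact: le_lt_trans le_e (ltry _).
by apply: esum_ge0 => x _; rewrite lee_fin.
Qed.

Lemma sum_le_esum f s : uniq s ->
  ((\sum_(p <- s) f p)%:E <= \esum_(x in [set: L]) (f x)%:E)%E.
Proof.
move=> us; apply: esum_ge; exists [set` s]; first by split.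
by rewrite -fsbig_seq// sumEFin.
Qed.

Lemma Prob_sum_le1 f s : Prob f -> uniq s -> \sum_(p <- s) f p <= 1.
Proof. by move=> [_ f1] us; rewrite -lee_fin -f1; exact: sum_le_esum. Qed.

Lemma Prob_l1le2 f g : Prob f -> Prob g -> l1le f g 2.
Proof.
move=> Pf Pg s us.
apply: le_trans (lerD (Prob_sum_le1 Pf us) (Prob_sum_le1 Pg us)).
rewrite -big_split/=; apply: ler_sum => p _.
by rewrite (le_trans (ler_normB _ _))// !ger0_norm//; [case: Pg|case: Pf].
Qed.

(** For probability measures the infinite sum is at most 2; an infinite one would be sent to 0 by
    [fine] and the norm would control nothing. *)
Lemma l1norm_l1le f g e : Prob f -> Prob g -> l1norm (f \- g) <= e -> l1le f g e.
Proof.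
move=> Pf Pg fge s us; apply: le_trans fge; rewrite -lee_fin fineK.
  exact: (sum_le_esum (fun x => `|f x - g x|)).
rewrite ge0_fin_numE; last by apply: esum_ge0 => x _; rewrite lee_fin.
apply: (@le_lt_trans _ _ 2%:E); last exact: ltry.
apply: ge_ereal_sup => _ [A [finA _] <-].
by rewrite fsbig_finite//= sumEFin lee_fin Prob_l1le2// fset_uniq.
Qed.

Lemma sum_sub f s t : uniq s -> uniq t -> {subset s <= t} ->
  \sum_(p <- t | p \in s) f p = \sum_(p <- s) f p.
Proof.
move=> us ut st; rewrite -big_filter; apply: perm_big; apply: uniq_perm => //.
  exact: filter_uniq.
by move=> p; rewrite mem_filter/=; apply: andb_idr => /st.
Qed.

Lemma sum_support f F s : (forall p, p \notin F -> f p = 0) -> uniq s ->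
  {subset F <= s} -> \sum_(p <- s) f p = \sum_(p <- undup F) f p.
Proof.
move=> f0 us Fs; rewrite (bigID (mem F))/= [X in _ + X]big1 ?addr0//.
rewrite -(sum_sub _ (undup_uniq F) us); last by move=> p; rewrite mem_undup => /Fs.
by apply: eq_bigl => p; rewrite mem_undup.
Qed.

Lemma sum_le_support f F s : (forall p, 0 <= f p) ->
  (forall p, p \notin F -> f p = 0) -> uniq s ->
  \sum_(p <- s) f p <= \sum_(p <- undup F) f p.
Proof.
move=> fge0 f0 us; have ut := undup_uniq (s ++ F).
rewrite -(sum_support f0 ut); last first.
  by move=> p pF; rewrite mem_undup mem_cat pF orbT.
rewrite -(sum_sub f us ut); last by move=> p ps; rewrite mem_undup mem_cat ps.
by rewrite [leRHS](bigID (mem s))/= lerDl sumr_ge0.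
Qed.

Lemma fprob_widen F F' v : fprob F v -> {subset F <= F'} -> fprob F' v.
Proof.
move=> [v0 vF v1] FF'; split => //.
  by move=> p pF'; apply: vF; apply: contra pF' => /FF'.
rewrite (sum_support vF) ?undup_uniq//.
by move=> p /FF'; rewrite mem_undup.
Qed.

Lemma fprob_Prob F v : fprob F v -> Prob v.
Proof.
move=> [v0 vF v1]; split => //.
rewrite -v1 (@esum_mkcond _ _ [set: L])/=.
transitivity (\esum_(i in [set` F]) (v i)%:E).
  rewrite [RHS]esum_mkcond; apply: eq_esum => i _; rewrite in_setT.
  by case: ifPn => //; rewrite notin_setE/= => /negP/vF ->.
rewrite esum_fset//; last by move=> *; rewrite lee_fin.
rewrite (_ : [set` F] = [set` undup F]).
  by rewrite -fsbig_seq ?undup_uniq// sumEFin.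
by apply/seteqP; split => p /=; rewrite mem_undup.
Qed.

Lemma fprob_le1 F v p : fprob F v -> v p <= 1.
Proof.
by move=> /fprob_Prob/(Prob_sum_le1 (s := [:: p])) => /(_ isT); rewrite big_seq1.
Qed.

Lemma fprob_delta (a : L) : fprob [:: a] (fun p => (p == a)%:R).
Proof.
split; first by move=> p; rewrite ler0n.
  by move=> p; rewrite inE => /negbTE ->.
by rewrite /= big_seq1 eqxx.
Qed.

(** Keep [w] on a finite set [S] of mass more than [1 - e / 2] and put the missing mass on the point
    [a]. The tail of [w] outside [S] and the atom added at [a] each cost at most [e / 2]. *)
Lemma Prob_approx (a : L) w e : 0 < e -> Prob w ->
  exists F v, fprob F v /\ l1le w v e.
Proof.
move=> e0 Pw; have [w0 w1] := Pw.
have e20 : 0 < e / 2 by rewrite divr_gt0.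
have : ((1 - e / 2)%:E < \esum_(x in [set: L]) (w x)%:E)%E.
  by rewrite w1 lte_fin ltrBlDr ltrDl.
move=> /ereal_sup_gt => -[_ [A [finA _] <-]].
rewrite fsbig_finite//= sumEFin lte_fin => wA.
set S : seq L := fset_set A in wA; have uS : uniq S by exact: fset_uniq.
pose r : R := 1 - \sum_(p <- S) w p.
have r0 : 0 <= r by rewrite subr_ge0; exact: Prob_sum_le1.
have re : r <= e / 2 by rewrite /r lerBlDr -lerBlDl ltW.
pose v p := (if p \in S then w p else 0) + r * (p == a)%:R.
have vE : fprob (a :: S) v.
  split.
  - move=> p; rewrite /v addr_ge0//; first by case: ifP.
    by rewrite mulr_ge0.
  - move=> p; rewrite inE negb_or => /andP[/negbTE pa /negbTE pS].
    by rewrite /v pS pa mulr0 addr0.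
  - have sub : {subset S <= undup (a :: S)}.
      by move=> p pS; rewrite mem_undup inE pS orbT.
    have suba : {subset [:: a] <= undup (a :: S)}.
      by move=> p; rewrite inE => /eqP ->; rewrite mem_undup mem_head.
    have us := undup_uniq (a :: S).
    rewrite big_split (sum_support _ us sub); last by move=> p /negbTE ->.
    rewrite -mulr_sumr (sum_support _ us suba); last first.
      by move=> p; rewrite inE => /negbTE ->.
    rewrite /= big_seq1 eqxx mulr1 undup_id//.
    rewrite [X in X + _](_ : _ = \sum_(p <- S) w p) ?subrKC// big_seq.
    by rewrite [RHS]big_seq; apply: eq_bigr => p ->.
exists (a :: S), v; split => //.
move=> s us.
apply: (@le_trans _ _ (\sum_(p <- s) ((if p \in S then 0 else w p)
    + r * (p == a)%:R))).
  apply: ler_sum => p _; rewrite /v; case: ifP => _.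
    rewrite opprD addNKr normrN add0r ger0_norm ?mulr_ge0//.
  by rewrite add0r (le_trans (ler_normB _ _))// !ger0_norm// mulr_ge0.
rewrite big_split/= [e]splitr lerD//.
  apply: le_trans re; rewrite /r lerBrDl.
  rewrite [X in _ + X](_ : _ = \sum_(p <- s | p \notin S) w p); last first.
    by rewrite [RHS]big_mkcond/=; apply: eq_bigr => p _; case: ifP.
  apply: le_trans (Prob_sum_le1 (s := S ++ [seq p <- s | p \notin S]) Pw _).
    by rewrite big_cat big_filter.
  rewrite cat_uniq uS filter_uniq// andbT; apply/hasPn => p.
  by rewrite mem_filter => /andP[].
rewrite -mulr_sumr; apply: le_trans re; rewrite ler_piMr//.
apply: (Prob_sum_le1 (f := fun p => (p == a)%:R)) => //.
exact: fprob_Prob (fprob_delta a).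
Qed.

End Choice.

Section Group.
Variable L : groupType.
Implicit Types (f g v : L -> R).

Lemma l1le_act (s : L) f g e : l1le f g e -> l1le (lact s f) (lact s g) e.
Proof.
move=> fg l ul; rewrite /lact.
rewrite -(big_map (fun p => s^-1 * p)%g xpredT (fun p => `|f p - g p|)).
by apply: fg; rewrite map_inj_uniq//; exact: mulgI.
Qed.

Lemma fprob_act (s : L) (F : seq L) v :
  fprob F v -> fprob [seq (s * p)%g | p <- F] (lact s v).
Proof.
move=> [v0 vF v1]; split; rewrite /lact.
- by [].
- move=> p pF; apply: vF; apply: contra pF => pF.
  by apply/mapP; exists (s^-1 * p)%g => //; rewrite mulVKg.
- rewrite undup_map_inj; last exact: mulgI.
  by rewrite big_map; under eq_bigr do rewrite mulKg.
Qed.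

Lemma Prob_act (s : L) v : Prob v -> Prob (lact s v).
Proof.
move=> [v0 v1]; split; first by move=> p; exact: v0.
rewrite -v1; apply/esym; apply: (reindex_esum _ _ (fun p => (s^-1 * p)%g)).
split => //.
  by move=> x y _ _; exact: mulgI.
by move=> p _; exists (s * p)%g => //; rewrite mulKg.
Qed.

End Group.

Definition approx_equivariant (G : groupType) : Prop :=
  forall (E : seq (G * G)) (e : R), 0 < e ->
  exists (F : seq (G * G)) (m : G -> G * G -> R),
    (forall x, fprob F (m x)) /\
    forall s, s \in E -> finite_set
      [set x | ~ l1le (lact s (m x)) (m (s.1 * x * s.2^-1)%g) e].

End FiniteProb.

(** * Characters and ultrafilters *)

Section Corona.
Variables (R : realType) (G : groupType).
Local Notation C := R[i].
Implicit Types (chi : corona R G) (A B : set G) (phi psi : linfty R G).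

(** Unbounded functions are sent to the default value 0. *)
Definition bounded_linfty (f : G -> C^o) : linfty R G := insubd 0 f.

Lemma bounded_linftyE (f : G -> C^o) (M : C) :
  (forall x, `|f x| <= M) -> bounded_linfty f = f :> (G -> C^o).
Proof. by move=> fM; rewrite [LHS]insubdK//; apply/asboolP; exists M. Qed.

Definition ev chi phi : C := corona_char chi (qclass phi).

Definition lindic A : linfty R G := bounded_linfty (fun x => (x \in A)%:R).

Lemma lindicE A x : lindic A x = (x \in A)%:R.
Proof.
rewrite /lindic (@bounded_linftyE _ 1)// => y.
by case: (y \in A); rewrite ?normr1 ?normr0 ?ler01.
Qed.

Lemma evD chi phi psi : ev chi (phi + psi) = ev chi phi + ev chi psi.
Proof.
by have [chiD _ _ _] := set_mem (valP chi); rewrite /ev qclassD; exact: chiD.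
Qed.

Lemma evZ chi c phi : ev chi (c *: phi) = c * ev chi phi.
Proof.
by have [_ chiZ _ _] := set_mem (valP chi); rewrite /ev qclassZ; exact: chiZ.
Qed.

Lemma evM chi phi psi : ev chi (phi * psi) = ev chi phi * ev chi psi.
Proof.
by have [_ _ chiM _] := set_mem (valP chi); rewrite /ev qclassM; exact: chiM.
Qed.

Lemma ev1 chi : ev chi 1 = 1.
Proof.
have [_ _ chiM [a chia]] := set_mem (valP chi).
have : ev chi (qrepr a) != 0 by rewrite /ev qreprK.
by move=> /mulfI; apply; rewrite -evM !mulr1.
Qed.

Lemma evB chi phi psi : ev chi (phi - psi) = ev chi phi - ev chi psi.
Proof. by rewrite -[- psi]scaleN1r evD evZ mulN1r. Qed.

Lemma ev_c0 chi phi : phi \in @c0_pred R G -> ev chi phi = 0.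
Proof.
move=> phi0; rewrite (_ : phi = phi - 0); last by rewrite subr0.
rewrite /ev (_ : qclass (phi - 0) = qclass 0); last first.
  by apply/qclass_eq; rewrite !subr0.
by have := evB chi 0 0; rewrite /ev !subr0 subrr.
Qed.

(* The nonprincipal ultrafilter along which [chi] is a limit. *)
Definition ultra chi : set_system G := [set A | ev chi (lindic A) = 1].

(** An indicator is idempotent, so a character takes the value 0 or 1 on it. *)
Lemma ev_lindic chi A : ev chi (lindic A) = 0 \/ ultra chi A.
Proof.
have : ev chi (lindic A) * ev chi (lindic A) = ev chi (lindic A).
  rewrite -evM; congr (ev _ _); apply/val_inj/funext => x.
  rewrite -[LHS]/(lindic A x * lindic A x) -[RHS]/(lindic A x) lindicE.
  by rewrite -natrM mulnb andbb.
move=> /eqP; rewrite -subr_eq0 -{3}[ev _ _]mulr1 -mulrBr mulf_eq0 subr_eq0.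
by move=> /orP[] /eqP ?; [left|right].
Qed.

Lemma ultraT chi : ultra chi setT.
Proof.
rewrite /ultra/= -(ev1 chi); congr (ev _ _); apply/val_inj/funext => x.
by rewrite -[LHS]/(lindic _ x) lindicE in_setT.
Qed.

Lemma ultraI chi A B : ultra chi A -> ultra chi B -> ultra chi (A `&` B).
Proof.
rewrite /ultra/= => A1 B1; rewrite (_ : lindic _ = lindic A * lindic B).
  by rewrite evM A1 B1 mulr1.
apply/val_inj/funext => x.
rewrite -[LHS]/(lindic _ x) -[RHS]/(lindic A x * lindic B x) !lindicE in_setI.
by rewrite -natrM mulnb.
Qed.

Lemma ultraC chi A : ultra chi (~` A) <-> ev chi (lindic A) = 0.
Proof.
rewrite /ultra/= (_ : lindic (~` A) = 1 - lindic A).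
  rewrite evB ev1; split => [/eqP|->]; last by rewrite subr0.
  by rewrite subr_eq addrC -subr_eq subrr eq_sym => /eqP.
apply/val_inj/funext => x.
rewrite -[LHS]/(lindic _ x) -[RHS]/(1 - lindic A x) !lindicE in_setC.
by case: (x \in A); rewrite ?subrr ?subr0.
Qed.

Lemma ultra0 chi : ~ ultra chi set0.
Proof.
have := ultraT chi; rewrite -[X in ultra _ X]setC0 => /ultraC; rewrite /ultra/=.
by move=> -> /eqP; rewrite eq_sym oner_eq0.
Qed.

Lemma ultraVC chi A : ultra chi A \/ ultra chi (~` A).
Proof. by have [/ultraC|] := ev_lindic chi A; [right|left]. Qed.

Lemma ultraS chi A B : A `<=` B -> ultra chi A -> ultra chi B.
Proof.
move=> AB A1; have [//|B1] := ultraVC chi B.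
suff : ultra chi set0 by move/ultra0.
by rewrite -((subsets_disjoint A B).1 AB); exact: ultraI.
Qed.

#[global] Instance ultra_filter chi : ProperFilter (ultra chi).
Proof.
split; first exact: ultra0.
split; [exact: ultraT|exact: ultraI|exact: ultraS].
Qed.

(** The indicator of a finite set is in c0, which characters kill; this is the nonprincipality of
    the ultrafilter. *)
Lemma ultra_cofinite chi A : finite_set (~` A) -> ultra chi A.
Proof.
move=> finA; rewrite -[A]setCK; apply/ultraC; apply: ev_c0; apply/c0P => eps e0.
apply: sub_finite_set finA => x /=; rewrite lindicE.
have [/set_mem//|_] := boolP (x \in ~` A).
by rewrite normr0 => /le_lt_trans/(_ e0); rewrite ltxx.
Qed.

(* If phi stays away from lambda on a set of the ultrafilter, then phi - lambda
   is invertible there. *)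
Lemma ev_neq chi phi A (l d : C) : ultra chi A -> 0 < d ->
  (forall x, A x -> d <= `|phi x - l|) -> ev chi phi != l.
Proof.
move=> A1 d0 Ad; apply/eqP => phil.
pose psi := bounded_linfty (fun x => (x \in A)%:R / (phi x - l)).
have psiE x : psi x = (x \in A)%:R / (phi x - l).
  rewrite /psi (@bounded_linftyE _ d^-1)// => y.
  have [/set_mem Ay|_] := boolP (y \in A); last by rewrite mul0r normr0 invr_ge0 ltW.
  by rewrite mul1r normfV lef_pV2 ?Ad ?posrE// (lt_le_trans d0)// Ad.
have : ev chi (psi * (phi - l *: (1 : linfty R G))) = ev chi (lindic A).
  congr (ev _ _); apply/val_inj/funext => x.
  rewrite -[LHS]/(psi x * (phi x - l * 1)) -[RHS]/(lindic A x) lindicE psiE mulr1.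
  have [/set_mem Ax|_] := boolP (x \in A); last by rewrite !mul0r.
  by rewrite mul1r mulVf// -normr_gt0 (lt_le_trans d0)// Ad.
rewrite evM evB evZ ev1 phil mulr1 subrr mulr0 A1 => /eqP.
by rewrite eq_sym oner_eq0.
Qed.

(** Otherwise [phi] would stay at distance at least [e] from its own value on a set of the
    ultrafilter, against [ev_neq]. *)
Lemma ev_near chi phi (e : C) : 0 < e ->
  ultra chi [set x | `|phi x - ev chi phi| < e].
Proof.
move=> e0; set A := [set x | _]; have [//|/ev_neq] := ultraVC chi A.
move=> /(_ phi (ev chi phi) e e0); rewrite eqxx => ev_neq; suff: false by []; apply: ev_neq => x /= /negP.
by rewrite -real_leNgt ?normr_real ?gtr0_real.
Qed.

(** If [ev chi phi] were further than [e] from [l], the triangle inequality would keep [phi] on [A]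
    at a fixed positive distance from [ev chi phi], against [ev_neq]. *)
Lemma ev_dist_le chi phi A (l e : C) : 0 <= e -> ultra chi A ->
  (forall x, A x -> `|phi x - l| <= e) -> `|ev chi phi - l| <= e.
Proof.
move=> e0 A1 Ae; have [//|] := boolP (_ <= e).
rewrite -real_ltNge ?normr_real ?ger0_real// => ltl.
have := @ev_neq chi phi A (ev chi phi) (`|ev chi phi - l| - e) A1.
rewrite subr_gt0 ltl eqxx => /(_ isT); apply: contraPP => _ H.
suff: false by []; apply: H => x Ax.
rewrite lerBlDr (le_trans (ler_distD (phi x) _ _))// distrC lerD2l.
exact: Ae.
Qed.

End Corona.

(** * Limits of bounded real functions along the ultrafilter of a character *)

Section RealLimit.
Variables (R : realType) (G : groupType).
Implicit Types (chi : corona R G) (f : G -> R).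

Definition real_linfty f : linfty R G := bounded_linfty (fun x => (f x)%:C).

Definition rlim chi f : R := complex.Re (ev chi (real_linfty f)).

Lemma real_linftyE f (M : R) x :
  (forall x, `|f x| <= M) -> real_linfty f x = (f x)%:C.
Proof.
move=> fM; rewrite /real_linfty (@bounded_linftyE _ _ _ M%:C)// => y.
by rewrite normc_def/= expr0n/= addr0 sqrtr_sqr lecR.
Qed.

Lemma ReB (x y : R[i]) : complex.Re (x - y) = complex.Re x - complex.Re y.
Proof. by case: x; case: y. Qed.

Lemma Re_dist_lt (x y : R[i]) (e : R) : `|x - y| < e%:C -> `|complex.Re x - complex.Re y| < e.
Proof. by rewrite -ReB -ltcR; apply: le_lt_trans; exact: normc_ge_Re. Qed.

Lemma rlim_cvg chi f (M : R) : (forall x, `|f x| <= M) ->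
  f @ ultra chi --> rlim chi f.
Proof.
move=> fM; apply/cvgrPdist_lt => e e0.
apply: filterS (ev_near chi (real_linfty f) (e := e%:C) _); last by rewrite ltcR.
by move=> x /=; rewrite (real_linftyE _ fM) distrC => /Re_dist_lt.
Qed.

Lemma rlimP chi f (l : R) (M : R) : (forall x, `|f x| <= M) ->
  f @ ultra chi --> l -> rlim chi f = l.
Proof.
move=> fM fl; apply/esym; apply: norm_cvg_unique fl _; exact: rlim_cvg fM.
Qed.

Lemma ev_act (s : G * G) chi phi :
  ev (corona_act s chi) phi = ev chi (translate s^-1%g phi).
Proof. by rewrite /ev -qtranslateE. Qed.

Lemma rlim_act (s : G * G) chi f (M : R) : (forall x, `|f x| <= M) ->
  rlim (corona_act s chi) f = rlim chi (fun x => f (s.1 * x * s.2^-1)%g).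
Proof.
move=> fM; rewrite /rlim ev_act; congr (complex.Re (ev _ _)); apply/val_inj/funext => x.
rewrite -[RHS]/(real_linfty _ x) (@real_linftyE _ M)//=.
by rewrite -[LHS]/(real_linfty _ _) (@real_linftyE _ M)// invgK.
Qed.

Lemma rlim_continuous f : continuous (fun chi => rlim chi f).
Proof.
move=> chi0; apply/(@cvgrPdist_lt _ _ _ (nbhs chi0) (nbhs_filter chi0)) => e e0.
have e0C : 0 < e%:C by rewrite ltcR.
have := @corona_eval_continuous R G (qclass (real_linfty f)) chi0.
move=> /(@cvgrPdist_lt _ _ _ (nbhs chi0) (nbhs_filter chi0)).
by move=> /(_ _ e0C); apply: filterS => chi; exact: Re_dist_lt.
Qed.

End RealLimit.

Lemma cvg_sumr (R : realType) (T I : Type) (F : set_system T) {FF : Filter F}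
    (s : seq I) (f : I -> T -> R) (l : I -> R) :
  (forall i, f i @ F --> l i) ->
  (fun x => \sum_(i <- s) f i x) @ F --> \sum_(i <- s) l i.
Proof.
move=> fl; elim: s => [|i s IHs].
  by under eq_fun do rewrite big_nil; rewrite big_nil; exact: cvg_cst.
under eq_fun do rewrite big_cons.
by rewrite big_cons; exact: (cvgD (fl i) IHs).
Qed.

Lemma directed_filter (I : Type) (le : I -> I -> Prop) :
  directed_order le -> ProperFilter (filter_from [set: I] le).
Proof.
move=> [[i0] lexx le_tr dir]; apply: filter_from_proper; last by move=> i _; exists i.
apply: filter_from_filter => [|i j _ _]; first by exists i0.
have [k [ik jk]] := dir i j; exists k => // l kl.
by split; [exact: le_tr ik kl|exact: le_tr jk kl].
Qed.

(** * From approximately equivariant maps to amenability of the corona action *)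

Section ToClassS.
Variables (R : realType) (G : groupType).

Section OneMap.
Variables (F : seq (G * G)) (m : G -> G * G -> R).
Hypothesis mF : forall x, fprob F (m x).

Let mhat (chi : corona R G) (p : G * G) : R := rlim chi (m ^~ p).

Let m_bounded p x : `|m x p| <= 1.
Proof. by rewrite ger0_norm; [exact: fprob_le1|case: (mF x)]. Qed.

(** All [m x] live on the same finite set [F], so the total mass is a finite sum and passes to the
    limit along the ultrafilter. *)
Lemma rlim_fprob chi : fprob F (mhat chi).
Proof.
have mcvg p := rlim_cvg (chi := chi) (m_bounded p).
split.
- by move=> p; apply: cvgr_to_ge (mcvg p) _; apply: nearW => x; case: (mF x).
- move=> p pF; apply: rlimP (m_bounded p) _.
  rewrite (_ : m ^~ p = cst 0); first exact: cvg_cst.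
  by apply/funext => x; case: (mF x) => _ /(_ _ pF).
- apply: (norm_cvg_unique (F := (fun x => \sum_(p <- undup F) m x p) @ ultra chi)) => //.
    exact: cvg_sumr.
  rewrite (_ : (fun x => _) = cst 1); first exact: cvg_cst.
  by apply/funext => x; case: (mF x).
Qed.

(** The exceptional set is finite, so each partial sum is at most [e] on a set of the ultrafilter,
    and the bound survives in the limit. *)
Lemma rlim_equivariant s (e : R) chi :
  finite_set [set x | ~ l1le (lact s (m x)) (m (s.1 * x * s.2^-1)%g) e] ->
  l1le (lact s (mhat chi)) (mhat (corona_act s chi)) e.
Proof.
move=> fin l ul.
have cvgl : (fun x => \sum_(p <- l)
      `|lact s (m x) p - m (s.1 * x * s.2^-1)%g p|) @ ultra chi -->
    \sum_(p <- l) `|lact s (mhat chi) p - mhat (corona_act s chi) p|.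
  apply: cvg_sumr => p; apply: cvg_norm; apply: cvgB.
    exact: rlim_cvg (m_bounded _).
  rewrite /mhat (rlim_act s chi (m_bounded p)).
  by apply: rlim_cvg => x; exact: m_bounded.
apply: (cvgr_to_le cvgl).
apply: (filterS (P := [set x | l1le (lact s (m x)) (m (s.1 * x * s.2^-1)%g) e])).
  by move=> x; exact.
exact: ultra_cofinite.
Qed.

(** Only the coordinates in [F] contribute to the norm, and each of them is continuous on the
    corona. *)
Lemma rlim_l1_continuous chi0 :
  l1norm (mhat chi \- mhat chi0) @[chi --> chi0] --> (0 : R).
Proof.
have FF := nbhs_filter chi0.
have sum0 : (fun chi => \sum_(p <- undup F) `|mhat chi p - mhat chi0 p|)
    @ nbhs chi0 --> (0 : R).
  rewrite [X in _ --> X](_ : 0 = \sum_(p <- undup F) `|mhat chi0 p - mhat chi0 p|).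
    apply: cvg_sumr => p; apply: cvg_norm; apply: cvgB; last exact: cvg_cst.
    exact: rlim_continuous.
  by rewrite big1// => p _; rewrite subrr normr0.
apply/cvgrPdist_le => e e0.
have /cvgrPdist_le/(_ e e0) := sum0; apply: filterS => chi.
rewrite !sub0r !normrN !ger0_norm ?sumr_ge0 ?fine_ge0 ?esum_ge0//.
apply: le_trans; apply: l1le_l1norm => l ul.
have [_ c0 _] := rlim_fprob chi; have [_ d0 _] := rlim_fprob chi0.
apply: sum_le_support => // p pF.
by rewrite c0// d0// subrr normr0.
Qed.

End OneMap.

Lemma approx_equivariant_classS : approx_equivariant R G -> classS R G.
Proof.
move=> aG.
have inv_gt0 n : 0 < n.+1%:R^-1 :> R by [].
have {aG} /choice[Fm] : forall i : seq (G * G) * nat,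
    exists Fm : seq (G * G) * (G -> G * G -> R),
    (forall x, fprob Fm.1 (Fm.2 x)) /\ forall s, s \in i.1 -> finite_set
      [set x | ~ l1le (lact s (Fm.2 x)) (Fm.2 (s.1 * x * s.2^-1)%g) i.2.+1%:R^-1].
  by move=> i; have [F [m Pm]] := aG i.1 _ (inv_gt0 i.2); exists (F, m).
move=> Pm.
(* The net is indexed by a finite list of pairs to be respected together with a precision
   [1 / (n + 1)]. *)
pose le (i j : seq (G * G) * nat) := {subset i.1 <= j.1} /\ (i.2 <= j.2)%N.
have dir : directed_order le.
  split.
  - by exists; exact: ([::], 0%N).
  - by move=> i; split.
  - move=> i j k [ij1 ij2] [jk1 jk2]; split; last exact: leq_trans jk2.
    by move=> x /ij1/jk1.
  - move=> i j; exists (i.1 ++ j.1, maxn i.2 j.2); split; split => /=.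
    + by move=> x xi; rewrite mem_cat xi.
    + exact: leq_maxl.
    + by move=> x xi; rewrite mem_cat xi orbT.
    + exact: leq_maxr.
have FF := directed_filter dir.
exists _, le, (fun i chi p => rlim chi ((Fm i).2 ^~ p)); split => //.
- by move=> i chi; exact: fprob_Prob (rlim_fprob (Pm i).1 chi).
- by move=> i chi; exact: (rlim_l1_continuous (Pm i).1 chi).
- move=> s; apply/cvgrPdist_le => e e0.
  have [n ne] : exists n, n.+1%:R^-1 <= e.
    by have := near_infty_natSinv_lt (PosNum e0) => -[n _ /(_ n (leqnn n))/ltW]; exists n.
  exists ([:: s], n) => // i [/= si ni].
  rewrite sub0r normrN; set S := [set _ | _ in _].
  have Se : ubound S e.
    move=> _ [chi _ <-]; apply: l1le_l1norm.
    have H := rlim_equivariant (Pm i).1 chi ((Pm i).2 s (si s (mem_head _ _))).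
    move=> l ul; apply: le_trans (H l ul) _.
    by apply: le_trans ne; rewrite lef_pV2 ?posrE// ler_nat.
  have S0 x : S x -> 0 <= x.
    by move=> [chi _ <-]; rewrite fine_ge0 ?esum_ge0.
  (* The corona is empty when [G] is finite; then [sup set0 = 0]. *)
  have [->|/set0P Sn0] := eqVneq S set0; first by rewrite sup0 normr0 ltW.
  rewrite ger0_norm; first exact: ge_sup.
  have [x Sx] := Sn0; apply: le_trans (S0 _ Sx) _.
  by apply: ub_le_sup => //; exists e.
Qed.

End ToClassS.

(** * Neighbourhoods in the corona in terms of ultrafilters *)

Section CoronaBasis.
Variables (R : realType) (G : groupType).

Lemma corona_cvg (F : set_system (corona R G)) (chi0 : corona R G) : Filter F ->
  (forall a, (fun chi => corona_char chi a) @ F --> corona_char chi0 a) ->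
  F --> chi0.
Proof.
move=> FF Fa.
have cvgF : (set_val : corona R G -> {ptws linfty_mod_c0 R G -> R[i]^o}) @ F
    --> (set_val chi0 : {ptws linfty_mod_c0 R G -> R[i]^o}).
  apply/cvg_sup => a V [_ [[W oW <-] Wchi0 WV]].
  have : nbhs (corona_char chi0 a) W by rewrite nbhsE; exists W.
  move=> /(Fa a) FW; apply: (@filterS _ F _ _ _ _ FW) => chi Wchi.
  exact: WV.
move=> V [_ [[W oW <-] Wchi0 WV]].
have : nbhs (set_val chi0 : {ptws linfty_mod_c0 R G -> R[i]^o}) W.
  by rewrite nbhsE; exists W.
move=> /cvgF FW; apply: (@filterS _ F _ _ _ _ FW) => chi Wchi.
exact: WV.
Qed.

(** The sets of characters whose ultrafilter contains [A], for [A] in [ultra chi0], generate a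
    filter converging to [chi0]: by [ev_near] and [ev_dist_le] each coordinate is nearly constant on
    a suitable such set. *)
Lemma corona_nbhs_ultra (chi0 : corona R G) (V : set (corona R G)) :
  nbhs chi0 V ->
  exists2 A, ultra chi0 A & forall chi, ultra chi A -> V chi.
Proof.
move=> chi0V.
pose F : set_system (corona R G) :=
  filter_from (ultra chi0) (fun A => [set chi | ultra chi A]).
have FF : Filter F.
  apply: filter_from_filter; first by exists setT; exact: ultraT.
  move=> A B A0 B0; exists (A `&` B); first exact: ultraI.
  by move=> chi AB; split; apply: ultraS AB => x [].
suff /(_ V chi0V) [A A0 AV] : F --> chi0 by exists A.
apply: corona_cvg => a; apply/cvgrPdist_le => e e0.
exists [set x | `|qrepr a x - ev chi0 (qrepr a)| < e]; first exact: ev_near.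
move=> chi /= Achi; rewrite distrC -[a]qreprK.
by apply: (ev_dist_le (ltW e0) Achi) => x /ltW.
Qed.

End CoronaBasis.

(** * Characters obtained from nonprincipal ultrafilters *)

Section UltraCharacter.
Variables (R : realType) (G : groupType) (U : set_system G).
Hypothesis UU : UltraFilter U.

(** The values stay in a compact interval, and a cluster point of an ultrafilter is a limit. *)
Lemma ultra_bounded_cvg (f : G -> R) (M : R) : (forall x, `|f x| <= M) ->
  f @ U --> lim (f @ U).
Proof.
move=> fM.
have cM : compact `[- M, M]%classic by exact: segment_compact.
have fU : (f @ U) `[- M, M]%classic.
  by apply: (@filterE _ U) => x /=; rewrite in_itv/= -ler_norml.
have [p [_ pU]] := cM (f @ U) _ fU.
suff fp : f @ U --> p by rewrite (cvg_lim (@Rhausdorff R) fp).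
move=> B Bp; have [//|UCB] := in_ultra_setVsetC (f @^-1` B) UU.
by have [x [/= nBx Bx]] := pU (~` B) B UCB Bp.
Qed.

Let re (phi : linfty R G) (x : G) : R := complex.Re (phi x).
Let im (phi : linfty R G) (x : G) : R := complex.Im (phi x).

Lemma normc_ge_Im (z : R[i]) : `|complex.Im z|%:C <= `|z|.
Proof.
by rewrite normc_def lecR -sqrtr_sqr ler_wsqrtr// lerDr sqr_ge0.
Qed.

Let re_bounded phi : exists M, forall x, `|re phi x| <= M.
Proof.
have [M phiM] := linfty_boundP phi; exists (complex.Re M) => x.
have := le_trans (normc_ge_Re _) (phiM x).
by rewrite lecE => /andP[].
Qed.

Let im_bounded phi : exists M, forall x, `|im phi x| <= M.
Proof.
have [M phiM] := linfty_boundP phi; exists (complex.Re M) => x.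
have := le_trans (normc_ge_Im _) (phiM x).
by rewrite lecE => /andP[].
Qed.

Let re_cvg phi : re phi @ U --> lim (re phi @ U).
Proof. by have [M] := re_bounded phi; exact: ultra_bounded_cvg. Qed.

Let im_cvg phi : im phi @ U --> lim (im phi @ U).
Proof. by have [M] := im_bounded phi; exact: ultra_bounded_cvg. Qed.

Definition ulim (phi : linfty R G) : R[i] :=
  lim (re phi @ U) +i* lim (im phi @ U).

Lemma ulimP phi (a b : R) : re phi @ U --> a -> im phi @ U --> b ->
  ulim phi = a +i* b.
Proof.
by move=> ra ib; rewrite /ulim (cvg_lim (@Rhausdorff R) ra)
  (cvg_lim (@Rhausdorff R) ib).
Qed.

Lemma linfty_addE (phi psi : linfty R G) x : (phi + psi) x = phi x + psi x.
Proof. by []. Qed.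

Lemma linfty_mulE (phi psi : linfty R G) x : (phi * psi) x = phi x * psi x.
Proof. by []. Qed.

Lemma ulimD phi psi : ulim (phi + psi) = ulim phi + ulim psi.
Proof.
apply: ulimP.
  rewrite (_ : re _ = re phi \+ re psi); first exact: cvgD.
  by apply/funext => x; rewrite /= /re linfty_addE;
    case: (phi x); case: (psi x).
rewrite (_ : im _ = im phi \+ im psi); first exact: cvgD.
by apply/funext => x; rewrite /= /im linfty_addE;
    case: (phi x); case: (psi x).
Qed.

Lemma ulimM phi psi : ulim (phi * psi) = ulim phi * ulim psi.
Proof.
apply: ulimP.
  rewrite (_ : re _ = (re phi \* re psi) \- (im phi \* im psi)).
    by apply: cvgB; exact: cvgM.
  by apply/funext => x; rewrite /= /re /im linfty_mulE;
    case: (phi x); case: (psi x).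
rewrite (_ : im _ = (re phi \* im psi) \+ (im phi \* re psi)).
  by apply: cvgD; exact: cvgM.
by apply/funext => x; rewrite /= /re /im linfty_mulE;
    case: (phi x); case: (psi x).
Qed.

Lemma ulim_near_cst (phi : linfty R G) (c : R[i]) : U [set x | phi x = c :> R[i]] -> ulim phi = c.
Proof.
case: c => a b Uc; apply: ulimP; apply: cvg_near_cst;
  by apply: filterS Uc => x /= phix; rewrite /re /im phix.
Qed.

Hypothesis Ucof : forall A, finite_set (~` A) -> U A.

Lemma ulim_c0 phi : phi \in @c0_pred R G -> ulim phi = 0.
Proof.
move=> /c0P phi0; rewrite [RHS](_ : 0 = 0 +i* 0)//.
have near0 (e : R) : 0 < e -> U [set x | `|phi x| < e%:C].
  move=> e0; apply: Ucof; apply: sub_finite_set (phi0 e%:C _); last by rewrite ltcR.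
  by move=> x /= /negP; rewrite -real_leNgt// ?normr_real// ger0_real// lecR ltW.
apply: ulimP; apply/cvgrPdist_lt => e /near0; apply: filterS => x /= xe.
  by rewrite sub0r normrN -ltcR (le_lt_trans (normc_ge_Re _)).
by rewrite sub0r normrN -ltcR (le_lt_trans (normc_ge_Im _)).
Qed.

Lemma ulim_qclass phi : ulim (qrepr (qclass phi)) = ulim phi.
Proof.
by rewrite -[qrepr _](subrK phi) ulimD ulim_c0 ?add0r// qclassK.
Qed.

(** By [ulim_qclass] the limit does not depend on the representative chosen by [qrepr], so the
    algebraic rules come from those of limits. *)
Lemma ulim_character : (fun a => ulim (qrepr a)) \in @characters R G.
Proof.
apply/mem_set; split.
- move=> a b; rewrite -[a]qreprK -[b]qreprK -qclassD !ulim_qclass.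
  by rewrite ulimD.
- move=> c a; rewrite -[a]qreprK -qclassZ !ulim_qclass linfty_scaleE ulimM.
  congr (_ * _); apply: ulim_near_cst; apply: filterE => x /=.
  by rewrite -[LHS]/(c * 1) mulr1.
- move=> a b; rewrite -[a]qreprK -[b]qreprK -qclassM !ulim_qclass.
  by rewrite ulimM.
- exists (qclass 1); rewrite ulim_qclass (@ulim_near_cst _ 1) ?oner_eq0//.
  exact: filterE.
Qed.

Definition ultra_corona : corona R G :=
  exist (fun f => f \in @characters R G) _ ulim_character.

Lemma ultra_ultra_corona A : U A -> ultra ultra_corona A.
Proof.
move=> UA; rewrite /ultra/= /ev -[corona_char _ _]/(ulim (qrepr _)) ulim_qclass.
by apply: ulim_near_cst; apply: filterS UA => x Ax /=; rewrite lindicE mem_set.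
Qed.

End UltraCharacter.

(** * From amenability of the corona action to approximately equivariant maps *)

Section FromClassS.
Variables (R : realType) (G : groupType).

Lemma ultra_act (s : G * G) (chi : corona R G) A :
  ultra (corona_act s chi) A -> ultra chi [set x | A (s.1 * x * s.2^-1)%g].
Proof.
rewrite /ultra/= ev_act => <-; congr (ev _ _); apply/val_inj/funext => x.
rewrite -[LHS]/(lindic _ _ x) -[RHS]/(lindic _ _ (s^-1%g.1^-1 * x * s^-1%g.2)%g).
by rewrite !lindicE invgK; congr (_%:R); apply/idP/idP => /set_mem ?; exact/mem_set.
Qed.

(** An ultrafilter refining the sets that contain all but finitely many points of [W] contains [W]
    and every cofinite set, hence defines a character. *)
Lemma infinite_ultra (W : set G) : infinite_set W -> exists chi : corona R G, ultra chi W.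
Proof.
move=> Winf; pose F : set_system G := [set S | finite_set (W `\` S)].
have FF : ProperFilter F.
  split; first by rewrite /F/= setD0.
  split; first by rewrite /F/= setDT.
    by move=> A B FA FB; rewrite /F/= setDIr finite_setU.
  by move=> A B AB; apply: sub_finite_set; exact: setDS.
have [U [UU FU]] := ultraFilterLemma FF.
have Ucof A : finite_set (~` A) -> U A.
  by move=> finA; apply: FU; apply: sub_finite_set finA => x [].
exists (ultra_corona R UU Ucof); apply: ultra_ultra_corona; apply: FU.
by rewrite /F/= setDv.
Qed.

Section Adapted.
Variables (M : corona R G -> G * G -> R) (e : R).
Hypotheses (e0 : 0 < e) (PM : forall chi, Prob (M chi))
  (M_continuous : forall chi0, l1norm (M chi \- M chi0) @[chi --> chi0] --> (0 : R)).

(* [q] approximates [M] on the clopen subset of the corona defined by [B].  The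
   adapted sets form an ideal containing the finite sets and meeting every
   [ultra chi]; a nonprincipal ultrafilter avoiding it would be some [ultra chi],
   so the ideal is improper. *)
Definition adapted (B : set G) := exists (F : seq (G * G)) q,
  (forall x, fprob F (q x)) /\ forall chi, ultra chi B ->
    exists2 v, ultra chi [set x | q x = v] & l1le (M chi) v e.

Lemma adapted_finite B : finite_set B -> adapted B.
Proof.
move=> finB; exists [:: 1%g], (fun _ p => (p == 1%g)%:R); split.
  by move=> _; exact: fprob_delta.
move=> chi chiB; have chiCB : ultra chi (~` B).
  by apply: ultra_cofinite; rewrite setCK.
by have := ultraI chiB chiCB; rewrite setICr => /ultra0.
Qed.

Lemma adapted_sub A B : A `<=` B -> adapted B -> adapted A.
Proof.
move=> AB [F [q [qF qB]]]; exists F, q; split => // chi /(ultraS AB).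
exact: qB.
Qed.

(** Use [q1] on [A] and [q2] off [A]: an ultrafilter that contains the union but not [A] contains
    [B] and the complement of [A]. *)
Lemma adaptedU A B : adapted A -> adapted B -> adapted (A `|` B).
Proof.
move=> [F1 [q1 [F1q1 q1A]]] [F2 [q2 [F2q2 q2B]]].
exists (F1 ++ F2), (fun x => if x \in A then q1 x else q2 x); split => [x|chi chiAB].
  case: ifP => _.
    by apply: fprob_widen (F1q1 x) _ => p pF; rewrite mem_cat pF.
  by apply: fprob_widen (F2q2 x) _ => p pF; rewrite mem_cat pF orbT.
have [chiA|chiCA] := ultraVC chi A.
  have [v chiv Mv] := q1A _ chiA; exists v => //.
  by apply: ultraS (ultraI chiA chiv) => x [/= Ax qv]; rewrite mem_set.
have chiB : ultra chi B.
  by apply: ultraS (ultraI chiCA chiAB) => x [? []].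
have [v chiv Mv] := q2B _ chiB; exists v => //.
by apply: ultraS (ultraI chiCA chiv) => x [/= Ax qv]; rewrite memNset.
Qed.

(** By continuity [M] varies by at most [e / 2] near [chi0], so a finitely supported approximation
    of [M chi0] to within [e / 2] serves as a constant [q]. *)
Lemma adapted_local (chi0 : corona R G) : exists2 A, ultra chi0 A & adapted A.
Proof.
have e20 : 0 < e / 2 by rewrite divr_gt0.
have [F [v [Fv Mv]]] := Prob_approx 1%g e20 (PM chi0).
have := M_continuous chi0.
move=> /(@cvgrPdist_lt _ _ _ (nbhs chi0) (nbhs_filter chi0))/(_ _ e20).
move=> /corona_nbhs_ultra[A chi0A Ae]; exists A => //.
exists F, (fun=> v); split => // chi /Ae.
rewrite sub0r normrN => /ltW chie; exists v.
  exact: filterE.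
rewrite [e]splitr; apply: l1le_trans Mv; apply: l1norm_l1le => //.
exact: le_trans (ler_norm _) chie.
Qed.

Lemma adapted_setT : adapted setT.
Proof.
apply: contrapT => nadT; pose F : set_system G := [set S | adapted (~` S)].
have FF : ProperFilter F.
  split; first by rewrite /F/= setC0.
  split; first by rewrite /F/= setCT; exact: adapted_finite.
    by move=> A B FA FB; rewrite /F/= setCI; exact: adaptedU.
  by move=> A B AB; apply: adapted_sub; exact: subsetC.
have [U [UU FU]] := ultraFilterLemma FF.
have Ucof A : finite_set (~` A) -> U A.
  by move=> finA; apply: FU; exact: adapted_finite.
have [A chiA adA] := adapted_local (ultra_corona R UU Ucof).
have UCA : U (~` A) by apply: FU; rewrite /F/= setCK.
have := ultraI chiA (ultra_ultra_corona R UU Ucof UCA).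
by rewrite setICr => /ultra0.
Qed.

End Adapted.

Lemma classS_approx_equivariant : classS R G -> approx_equivariant R G.
Proof.
move=> [I [le [m [dir Pm m_cont m_lim]]]] E e e0.
have FF := directed_filter dir.
(* One third is for the equivariance of [m i], the other two for the approximations by [q] at [chi]
   and at its translate. *)
have e30 : 0 < e / 3 by rewrite divr_gt0.
pose P s i := forall chi, l1le (lact s (m i chi)) (m i (corona_act s chi)) (e / 3).
have Ps s : \forall i \near filter_from [set: I] le, P s i.
  have /cvgrPdist_le/(_ _ e30) := m_lim s.
  apply: filterS => i; rewrite sub0r normrN; set S := [set _ | _ in _] => supS chi.
  apply: l1norm_l1le; [exact: Prob_act|exact: Pm|].
  apply: le_trans supS; apply: le_trans (ler_norm _).
  apply: ub_le_sup; last by exists chi.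
  (* [sup] is a true supremum only for a set bounded above; distances of probability measures are at
     most 2. *)
  exists 2 => _ [chi' _ <-]; apply: l1le_l1norm.
  by apply: Prob_l1le2; [exact: Prob_act|exact: Pm].
have : \forall i \near filter_from [set: I] le, forall s, s \in E -> P s i.
  elim: E => [|s E IHE]; first exact: filterE.
  apply: filterS2 (Ps s) IHE => i Psi PEi t; rewrite inE => /predU1P[->//|].
  exact: PEi.
move=> /filter_ex[i Pi].
have [F [q [Fq qM]]] := adapted_setT e30 (Pm i) (m_cont i).
(* If infinitely many [x] failed, some ultrafilter would contain the set of failures. At a suitable
   such [x], [q] takes at [x] and at its translate the values attached to [chi] and to its
   translate, and the three estimates contradict the failure. *)
exists F, q; split => // s sE; apply: contrapT => /infinite_ultra[chi chiW].
have [v chiv Mv] := qM _ (ultraT chi).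
have [w /ultra_act chiw Mw] := qM _ (ultraT (corona_act s chi)).
have [x [[/= nx qv] qw]] := filter_ex (filterI (filterI chiW chiv) chiw).
apply: nx; rewrite qv qw (_ : e = e / 3 + (e / 3 + e / 3)); last lra.
apply: l1le_trans (l1le_act s (l1le_sym Mv)) _.
by apply: l1le_trans Mw; exact: Pi.
Qed.

End FromClassS.

(** * Averages of bounded measurable functions *)

Section DiscreteMap.
Context d (T : measurableType d) (K : choiceType).
Hypothesis countK : countable [set: K].

(** For countable [K] this gives measurability of all preimages without a sigma-algebra on [K]. *)
Definition level_measurable (h : T -> K) := forall k, measurable (h @^-1` [set k]).

Variable h : T -> K.
Hypothesis mh : level_measurable h.

Lemma level_measurable_preimage (S : set K) : measurable (h @^-1` S).
Proof.
rewrite (_ : _ @^-1` _ = \bigcup_k (if k \in S then h @^-1` [set k] else set0)).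
  by apply: countable_bigcupT_measurable => // k; case: ifP.
apply/seteqP; split => x /=.
  by move=> Shx; exists (h x) => //; rewrite mem_set.
by move=> [k _]; case: ifP => // /set_mem Sk /= ->.
Qed.

Lemma measurable_fun_level (R : realType) (g : K -> R) :
  measurable_fun setT (g \o h).
Proof.
by move=> _ Y _; rewrite setTI comp_preimage; exact: level_measurable_preimage.
Qed.

End DiscreteMap.

Section Mean.
Context d (T : measurableType d) (R : realType) (P : {measure set T -> \bar R}).
Hypothesis P1 : P setT = 1%E.
Implicit Types (A B : set T) (f g : T -> R).

Let finP A : measurable A -> P A \is a fin_num.
Proof.
move=> mA; rewrite ge0_fin_numE//; apply: (@le_lt_trans _ _ (P setT)).
  by apply: le_measure; rewrite ?inE.
by rewrite P1 ltry.
Qed.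

Definition pr A : R := fine (P A).

Lemma pr_le A B : measurable A -> measurable B -> A `<=` B -> pr A <= pr B.
Proof.
move=> mA mB AB; rewrite /pr fine_le ?finP//.
by apply: le_measure; rewrite ?inE.
Qed.

Lemma prU A B : measurable A -> measurable B -> pr (A `|` B) <= pr A + pr B.
Proof.
move=> mA mB; rewrite /pr -fineD ?finP// fine_le ?fin_numD ?finP//.
  exact: measurableU.
exact: measureU2.
Qed.

(** Enumerate [K]: the events that the index of [h x] is at least [i] decrease to the empty set, so
    their measures tend to 0. *)
Lemma pr_tight (K : choiceType) (h : T -> K) (e : R) :
  countable [set: K] -> level_measurable h -> 0 < e ->
  exists s : seq K, pr [set x | h x \notin s] <= e.
Proof.
move=> cK mh e0; have /countable_injP[n ninj] := cK.
pose A i := h @^-1` [set k | (i <= n k)%N].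
have mA i : measurable (A i) by exact: level_measurable_preimage.
have A0 : \bigcap_i A i = set0.
  by rewrite -subset0 => x /(_ (n (h x)).+1 Logic.I)/=; rewrite /A/= ltnn.
have : P \o A @ \oo --> P (\bigcap_i A i).
  apply: nonincreasing_cvg_mu => //; last 2 first.
  - by rewrite A0.
  - move=> i j ij; apply/subsetPset => x; rewrite /A/=; exact: leq_trans.
  by rewrite -ge0_fin_numE// finP.
rewrite A0 measure0 => /fine_cvgP[_ /cvgrPdist_le/(_ _ e0)][i _ /(_ _ (leqnn i))].
rewrite /= sub0r normrN ger0_norm ?fine_ge0// => Pe.
have finS : finite_set (n @^-1` `I_i).
  apply: finite_preimage (finite_II i).
  by move=> x y _ _; apply: ninj; rewrite in_setT.
have /finite_seqP[s sE] := finS.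
exists s; rewrite (_ : [set x | _] = A i)//.
apply/seteqP; split => x; rewrite /A/= leqNgt.
  by move=> xs; apply: contra xs => xi; move: (xi : (n @^-1` `I_i) (h x)); rewrite sE.
by apply: contra => xs; have : [set` s] (h x) by []; rewrite -sE.
Qed.

Lemma measurable_exists_notin (I : eqType) (K : choiceType) (u : I -> T -> K)
    (l : seq I) (s : seq K) :
  countable [set: K] -> (forall i, level_measurable (u i)) ->
  measurable [set x | exists2 i, i \in l & u i x \notin s].
Proof.
move=> cK mu; rewrite (_ : [set x | _] =
    \bigcup_(i in [set` l]) (u i @^-1` [set k | k \notin s])).
  apply: fin_bigcup_measurable; first exact: finite_seq.
  by move=> i _; exact: level_measurable_preimage.
by apply/seteqP; split => x [i il /= us]; exists i.
Qed.

Lemma pr_tight_seq (I : eqType) (K : choiceType) (u : I -> T -> K) (l : seq I) (e : R) :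
  countable [set: K] -> (forall i, level_measurable (u i)) -> 0 < e ->
  exists s : seq K, pr [set x | exists2 i, i \in l & u i x \notin s] <= e.
Proof.
move=> cK mu; elim: l e => [|i l IHl] e e0.
  exists [::]; rewrite (_ : [set x | _] = set0) /pr ?measure0 ?ltW//.
  by rewrite -subset0 => x [].
have e20 : 0 < e / 2 by rewrite divr_gt0.
have [s1 s1e] := pr_tight cK (mu i) e20.
have [s2 s2e] := IHl _ e20.
have m1 : measurable [set x | u i x \notin s1].
  exact: (level_measurable_preimage cK (mu i) [set k | k \notin s1]).
have m2 : measurable [set x | exists2 i, i \in l & u i x \notin s2].
  exact: measurable_exists_notin.
exists (s1 ++ s2); rewrite [e]splitr.
apply: le_trans (lerD s1e s2e); apply: le_trans (prU m1 m2); apply: pr_le.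
- exact: measurable_exists_notin.
- exact: measurableU.
- move=> x [j]; rewrite inE mem_cat negb_or => /predU1P[->|jl] /andP[us1 us2].
    by left.
  by right; exists j.
Qed.

Definition bounded_measurable f :=
  measurable_fun setT f /\ exists M, forall x, `|f x| <= M.

Lemma bounded_measurable_integrable f :
  bounded_measurable f -> P.-integrable setT (EFin \o f).
Proof.
move=> [mf [M fM]]; apply: measurable_bounded_integrable => //.
  by rewrite P1 ltry.
exists M; split; first exact: num_real.
by move=> N /ltW MN x _; exact: le_trans MN.
Qed.

Lemma bounded_measurable_cst (c : R) : bounded_measurable (cst c).
Proof. by split; [exact: measurable_cst|exists `|c|]. Qed.

Lemma bounded_measurableB f g : bounded_measurable f -> bounded_measurable g ->
  bounded_measurable (fun x => f x - g x).
Proof.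
move=> [mf [M fM]] [mg [N gN]]; split; first exact: measurable_funB.
exists (M + N) => x; rewrite (le_trans (ler_normB _ _))//.
by rewrite lerD.
Qed.

Lemma bounded_measurableD f g : bounded_measurable f -> bounded_measurable g ->
  bounded_measurable (fun x => f x + g x).
Proof.
move=> [mf [M fM]] [mg [N gN]]; split; first exact: measurable_funD.
exists (M + N) => x; rewrite (le_trans (ler_normD _ _))//.
by rewrite lerD.
Qed.

Lemma bounded_measurableM f g : bounded_measurable f -> bounded_measurable g ->
  bounded_measurable (fun x => f x * g x).
Proof.
move=> [mf [M fM]] [mg [N gN]]; split; first exact: measurable_funM.
by exists (M * N) => x; rewrite normrM ler_pM.
Qed.

Lemma bounded_measurable_norm f : bounded_measurable f ->
  bounded_measurable (fun x => `|f x|).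
Proof.
move=> [mf [M fM]]; split; first exact: measurableT_comp.
by exists M => x; rewrite normr_id.
Qed.

Lemma bounded_measurable_sum (I : eqType) (s : seq I) (f : I -> T -> R) :
  {in s, forall i, bounded_measurable (f i)} ->
  bounded_measurable (fun x => \sum_(i <- s) f i x).
Proof.
elim: s => [|i s IHs] mf.
  by under eq_fun do rewrite big_nil; exact: bounded_measurable_cst.
under eq_fun do rewrite big_cons; apply: bounded_measurableD.
  by apply: mf; exact: mem_head.
by apply: IHs => j js; apply: mf; rewrite inE js orbT.
Qed.

Lemma bounded_measurable_indic A : measurable A -> bounded_measurable (\1_A).
Proof.
move=> mA; split; first exact: measurable_indic.
by exists 1 => x; rewrite indicE; case: (x \in A); rewrite ?normr1 ?normr0.
Qed.

Lemma bounded_measurable_level (K : choiceType) (h : T -> K) (g : K -> R) (M : R) :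
  countable [set: K] -> level_measurable h -> (forall k, `|g k| <= M) ->
  bounded_measurable (g \o h).
Proof.
move=> cK mh gM; split; first exact: measurable_fun_level.
by exists M => x; exact: gM.
Qed.

Lemma bounded_measurable_comp f (theta : T -> T) : measurable_fun setT theta ->
  bounded_measurable f -> bounded_measurable (f \o theta).
Proof.
move=> mt [mf [M fM]]; split; first exact: measurableT_comp.
by exists M => x; exact: fM.
Qed.

Definition mean f : R := \int[P]_x f x.

Lemma mean_cst (c : R) : mean (cst c) = c.
Proof. by rewrite /mean Rintegral_cst// P1 mulr1. Qed.

Lemma mean_indic A : measurable A -> mean (\1_A) = pr A.
Proof. by move=> mA; rewrite /mean /Rintegral integral_indic// setIT. Qed.

Lemma le_mean f g : bounded_measurable f -> bounded_measurable g ->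
  (forall x, f x <= g x) -> mean f <= mean g.
Proof.
by move=> mf mg fg; apply: le_Rintegral => //; exact: bounded_measurable_integrable.
Qed.

Lemma meanB f g : bounded_measurable f -> bounded_measurable g ->
  mean (fun x => f x - g x) = mean f - mean g.
Proof.
by move=> mf mg; apply: RintegralB => //; exact: bounded_measurable_integrable.
Qed.

Lemma meanD f g : bounded_measurable f -> bounded_measurable g ->
  mean (fun x => f x + g x) = mean f + mean g.
Proof.
by move=> mf mg; apply: RintegralD => //; exact: bounded_measurable_integrable.
Qed.

Lemma meanZ f c : bounded_measurable f -> mean (fun x => c * f x) = c * mean f.
Proof.
by move=> mf; apply: RintegralZl => //; exact: bounded_measurable_integrable.
Qed.

Lemma mean_sum (I : eqType) (s : seq I) (f : I -> T -> R) :
  {in s, forall i, bounded_measurable (f i)} ->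
  mean (fun x => \sum_(i <- s) f i x) = \sum_(i <- s) mean (f i).
Proof.
elim: s => [|i s IHs] mf.
  by under eq_fun do rewrite big_nil; rewrite big_nil -[RHS]mean_cst.
have mfs : {in s, forall j, bounded_measurable (f j)}.
  by move=> j js; apply: mf; rewrite inE js orbT.
under eq_fun do rewrite big_cons.
rewrite big_cons meanD ?IHs//; last exact: bounded_measurable_sum.
by apply: mf; exact: mem_head.
Qed.

Lemma mean_norm f : bounded_measurable f -> `|mean f| <= mean (fun x => `|f x|).
Proof.
by move=> mf; apply: le_normr_Rintegral => //; exact: bounded_measurable_integrable.
Qed.

Lemma mean_comp (theta : T -> T) f : measurable_fun setT theta ->
  (forall A, measurable A -> P (theta @^-1` A) = P A) ->
  bounded_measurable f -> mean (f \o theta) = mean f.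
Proof.
move=> mt Pt mf; rewrite /mean /Rintegral; congr fine.
transitivity (\int[pushforward P theta]_x (f x)%:E)%E.
  rewrite integral_pushforward//.
  - by apply/measurable_EFinP; case: mf.
  - rewrite preimage_setT; apply: (bounded_measurable_integrable (f := f \o theta)).
    exact: bounded_measurable_comp.
by apply: eq_measure_integral => A mA _; exact: Pt.
Qed.

Lemma pr_comp (theta : T -> T) A :
  (forall A, measurable A -> P (theta @^-1` A) = P A) -> measurable A ->
  pr (theta @^-1` A) = pr A.
Proof. by move=> Pt mA; rewrite /pr Pt. Qed.

End Mean.

(** * Induction along a cocycle *)

Section Push.
Variable R : realType.

(** For [v] supported in [F] this is the image measure under [Phi]. *)
Definition push (L L' : choiceType) (F : seq L) (Phi : L -> L') (v : L -> R)
    (p : L') : R :=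
  \sum_(f <- undup F) v f * (Phi f == p)%:R.

Lemma sum_indic_le1 (L : choiceType) (a : L) (s : seq L) : uniq s ->
  \sum_(p <- s) (a == p)%:R <= 1 :> R.
Proof.
move=> us; have := Prob_sum_le1 (fprob_Prob (fprob_delta R a)) us.
by apply: le_trans; apply: ler_sum => p _; rewrite eq_sym.
Qed.

Lemma push_fprob (L L' : choiceType) (F : seq L) (F' : seq L') Phi v :
  fprob F v -> (forall f, f \in F -> Phi f \in F') -> fprob F' (push F Phi v).
Proof.
move=> [v0 vF v1] FF'; split.
- by move=> p; apply: sumr_ge0 => f _; rewrite mulr_ge0.
- move=> p pF'; rewrite /push big_seq big1// => f; rewrite mem_undup => fF.
  case: eqP => [fp|_]; last by rewrite mulr0.
  by rewrite -fp FF' in pF'.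
- rewrite exchange_big/= -[RHS]v1 [LHS]big_seq [RHS]big_seq; apply: eq_bigr => f.
  rewrite mem_undup => fF; rewrite -mulr_sumr.
  rewrite (bigD1_seq (Phi f)) ?undup_uniq ?mem_undup ?FF'//= eqxx.
  rewrite [X in _ + X]big1 ?addr0 ?mulr1// => p.
  by rewrite eq_sym => /negbTE ->.
Qed.

Lemma push_widen (L L' : choiceType) (F s : seq L) (Phi : L -> L') v p :
  fprob F v -> {subset F <= s} -> push s Phi v p = push F Phi v p.
Proof.
move=> [_ vF _] Fs; rewrite /push (sum_support (F := F)) ?undup_uniq//.
  by move=> f /vF ->; rewrite mul0r.
by move=> f /Fs; rewrite mem_undup.
Qed.

(** Sum both measures over the common list [H] and exchange the sums: each [f] is counted at most
    once, since [Phi f] equals at most one [p] of the list. *)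
Lemma push_l1le (L L' : choiceType) (F F' : seq L) (Phi : L -> L') v v' e :
  fprob F v -> fprob F' v' -> l1le v v' e ->
  l1le (push F Phi v) (push F' Phi v') e.
Proof.
move=> Fv Fv' ve s us.
pose H := F ++ F'.
have FH : {subset F <= H} by move=> f fF; rewrite mem_cat fF.
have F'H : {subset F' <= H} by move=> f fF; rewrite mem_cat fF orbT.
under eq_bigr do rewrite -(push_widen _ _ Fv FH) -(push_widen _ _ Fv' F'H).
apply: le_trans (ve _ (undup_uniq H)).
apply: (@le_trans _ _ (\sum_(p <- s) \sum_(f <- undup H)
    `|v f - v' f| * (Phi f == p)%:R)).
  apply: ler_sum => p _; rewrite /push -sumrB (le_trans (ler_norm_sum _ _ _))//.
  by apply: ler_sum => f _; rewrite -mulrBl normrM [X in _ * X]ger0_norm.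
rewrite exchange_big/=; apply: ler_sum => f _.
by rewrite -mulr_sumr ler_piMr// sum_indic_le1.
Qed.

Lemma eq_push (L L' : choiceType) (F : seq L) (Phi Psi : L -> L') (v : L -> R) :
  (forall f, f \in F -> Phi f = Psi f) -> push F Phi v = push F Psi v.
Proof.
move=> PhiPsi; apply/funext => p; rewrite /push big_seq [RHS]big_seq.
by apply: eq_bigr => f; rewrite mem_undup => /PhiPsi ->.
Qed.

Lemma lact_push (L : choiceType) (L' : groupType) (F : seq L) (Phi : L -> L') v s :
  lact s (push F Phi v) = push F (fun f => s * Phi f)%g v :> (L' -> R).
Proof.
apply/funext => p; rewrite /push /lact; apply: eq_bigr => f _; congr (_ * (nat_of_bool _)%:R).
by apply/eqP/eqP => [->|<-]; rewrite ?mulVKg ?mulKg.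
Qed.

Lemma push_lact (L : groupType) (L' : choiceType) (F : seq L) (Phi : L -> L')
    (v : L -> R) s :
  push [seq (s * f)%g | f <- F] Phi (lact s v) = push F (fun f => Phi (s * f)%g) v.
Proof.
apply/funext => p; rewrite /push /lact undup_map_inj ?big_map; last exact: mulgI.
by apply: eq_bigr => f _; rewrite mulKg.
Qed.

End Push.

(** * Transfer of approximate equivariance through a cocycle *)

Section CocycleTransfer.
Context d (T : measurableType d) (R : realType) (P : {measure set T -> \bar R}).
Variables (G Gam : groupType) (X : set T).
Variables (theta : G -> T -> T) (alpha : G -> T -> Gam) (u : Gam -> T -> G).
Hypotheses (countG : countable [set: G]) (countGam : countable [set: Gam]).
Hypotheses (P1 : P setT = 1%E) (mX : measurable X) (PX : P (~` X) = 0%E).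
Hypotheses (mtheta : forall g, measurable_fun setT (theta g))
  (Ptheta : forall g A, measurable A -> P (theta g @^-1` A) = P A)
  (malpha : forall g, level_measurable (alpha g))
  (mu : forall c, level_measurable (u c)).
(** In a coupling [theta g x] is [g x] brought back to [X] by the inverse of [alpha g x], and
    [u k x] is the [G]-coordinate of [k^-1 x]; the two actions commute, whence the order of the
    factors. The identities are asked on [X], which has full measure. *)
Hypotheses
  (alphaM : forall g h x, X x ->
    alpha (g * h)%g x = (alpha h x * alpha g (theta h x))%g)
  (thetaM : forall g h x, X x -> theta (g * h)%g x = theta g (theta h x))
  (u_theta : forall c g x, X x -> u c (theta g x) = (g * u (alpha g x * c) x)%g).

Let pr_theta g A : measurable A -> pr P (theta g @^-1` A) = pr P A.
Proof. by move=> mA; apply: pr_comp => // B; exact: Ptheta. Qed.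

Let mtheta_preimage g A : measurable A -> measurable (theta g @^-1` A).
Proof. by move=> mA; rewrite -[_ @^-1` _]setTI; exact: mtheta. Qed.

Let level_theta (K : choiceType) (h : T -> K) g :
  level_measurable h -> level_measurable (h \o theta g).
Proof. by move=> mh k; rewrite comp_preimage; exact: mtheta_preimage. Qed.

Let prXC : pr P (~` X) = 0. Proof. by rewrite /pr PX. Qed.

(** On [X], [g] is the product of [u 1 (theta g x)] and the inverse of [u (alpha g x) x]. When
    [alpha g x] is in [K], these lie in finite sets [D1] and [D2] up to measure [e], so only
    finitely many [g] can fail. *)
Lemma cocycle_proper (K : seq Gam) e : 0 < e ->
  finite_set [set g | ~ (pr P [set x | alpha g x \in K] <= e)].
Proof.
move=> e0; have e20 : 0 < e / 2 by rewrite divr_gt0.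
have [D1 D1e] := pr_tight P1 countG (mu 1%g) e20.
have [D2 D2e] := pr_tight_seq P1 K countG mu e20.
have m1 : measurable [set x | u 1%g x \notin D1].
  exact: (level_measurable_preimage countG (mu 1%g) [set k | k \notin D1]).
have m2 : measurable [set x | exists2 c, c \in K & u c x \notin D2].
  exact: measurable_exists_notin.
apply: (@sub_finite_set _ _ [set` [seq (a * b^-1)%g | a <- D1, b <- D2]]); last first.
  exact: finite_seq.
move=> g /= ng; apply/negPn/negP => gD; apply: ng.
rewrite [e]splitr -[leRHS]add0r -prXC addrA.
apply: le_trans (lerD (lerD (lexx _) D1e) D2e).
rewrite -(pr_theta g m1).
have mXC := measurableC mX; have mt1 := mtheta_preimage g m1.
apply: le_trans (lerD (prU P1 mXC mt1) (lexx _)).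
apply: le_trans (prU P1 (measurableU _ _ mXC mt1) m2).
apply: pr_le => //.
- exact: (level_measurable_preimage countGam (malpha g) [set k | k \in K]).
- by apply: measurableU => //; exact: measurableU.
move=> x /= gK; have [Xx|] := pselect (X x); last by left; left.
have [D1x|] := boolP (u 1%g (theta g x) \in D1); last by left; right.
have [D2x|] := boolP (u (alpha g x) x \in D2); last by right; exists (alpha g x).
move/negP: gD; case; apply/allpairsP; exists (u 1%g (theta g x), u (alpha g x) x).
by split => //=; rewrite u_theta// mulg1 mulgK.
Qed.

Section Kernel.
Variables (F : seq (Gam * Gam)) (m : Gam -> Gam * Gam -> R) (D : seq G).
Hypothesis Fm : forall c, fprob F (m c).

(* Truncating the values to a finite set makes the kernel finitely supported. *)
Let w (a : G) : G := if a \in D then a else 1%g.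

Let wD a : w a \in 1%g :: D.
Proof. by rewrite /w inE; case: ifP => [->|]; rewrite ?orbT ?eqxx. Qed.

Definition kernel_map g x (f : Gam * Gam) : G * G :=
  (w (u f.1 (theta g x)), w (u f.2 x)).

Definition kernel g x : G * G -> R := push F (kernel_map g x) (m (alpha g x)^-1%g).

Definition kernel_supp : seq (G * G) := [seq (a, b) | a <- 1%g :: D, b <- 1%g :: D].

Lemma kernel_fprob g x : fprob kernel_supp (kernel g x).
Proof.
apply: push_fprob => // f _; apply/allpairsP; exists (kernel_map g x f).
by split; rewrite /= ?wD.
Qed.

Lemma kernel_bounded_measurable g p :
  bounded_measurable (fun x => kernel g x p).
Proof.
apply: bounded_measurable_sum => f _; apply: bounded_measurableM.
  apply: (bounded_measurable_level (g := fun c => m c^-1%g f) (h := alpha g) (M := 1)) => //.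
  by move=> c; rewrite ger0_norm; [exact: fprob_le1|case: (Fm c^-1%g)].
case: p => p1 p2.
rewrite (_ : (fun x => _) = fun x => (w (u f.1 (theta g x)) == p1)%:R
    * (w (u f.2 x) == p2)%:R); last first.
  by apply/funext => x; rewrite -natrM mulnb.
apply: bounded_measurableM.
  apply: (bounded_measurable_level (g := fun a => (w a == p1)%:R)
    (h := u f.1 \o theta g) (M := 1)) => //.
    exact: level_theta.
  by move=> a; case: (_ == _); rewrite ?normr1 ?normr0.
apply: (bounded_measurable_level (g := fun a => (w a == p2)%:R)
  (h := u f.2) (M := 1)) => //.
by move=> a; case: (_ == _); rewrite ?normr1 ?normr0.
Qed.

(** Off this set [w] changes no value of [u] at a coordinate of a point of [F]. *)
Definition truncated : set T :=
  [set x | exists2 c, c \in [seq f.1 | f <- F] ++ [seq f.2 | f <- F] & u c x \notin D].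

Lemma not_truncated x f : f \in F -> ~ truncated x ->
  w (u f.1 x) = u f.1 x /\ w (u f.2 x) = u f.2 x.
Proof.
move=> fF nx; have H c : c \in [seq f.1 | f <- F] ++ [seq f.2 | f <- F] ->
    w (u c x) = u c x.
  move=> cF; rewrite /w; case: ifPn => // ucx.
  by exfalso; apply: nx; exists c.
by split; apply: H; rewrite mem_cat; apply/orP; [left|right]; apply/mapP; exists f.
Qed.

(* With b := alpha s (theta g x) and b' := alpha t x one has
   (alpha (s g t^-1) (theta t x))^-1 = b^-1 (alpha g x)^-1 b'. *)
Lemma kernel_equivariant g s t x e : X x ->
  ~ truncated x -> ~ truncated (theta g x) -> ~ truncated (theta t x) ->
  ~ truncated (theta (s * g)%g x) ->
  (let b := alpha s (theta g x) in let b' := alpha t x in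
   let c := (alpha g x)^-1%g in
   l1le (lact (b^-1, b'^-1)%g (m c)) (m (b^-1 * c * b')%g) e) ->
  l1le (lact (s, t) (kernel g x)) (kernel (s * g * t^-1)%g (theta t x)) e.
Proof.
move=> Xx tx tgx ttx tsgx /=.
set b := alpha s _; set b' := alpha t x; set c := (alpha g x)^-1%g => me.
have sgt : theta (s * g * t^-1)%g (theta t x) = theta (s * g)%g x.
  by rewrite -thetaM// mulgVK.
have alpha_sg : alpha (s * g)%g x = (alpha g x * b)%g by rewrite alphaM.
have alpha_sgt : (alpha (s * g * t^-1)%g (theta t x))^-1%g = (b^-1 * c * b')%g.
  have := @alphaM (s * g * t^-1)%g t x Xx; rewrite mulgVK alpha_sg -/b' => H.
  have -> : alpha (s * g * t^-1)%g (theta t x) = (b'^-1 * (alpha g x * b))%g.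
    by rewrite H mulKg.
  by rewrite !invgM invgK.
rewrite /kernel alpha_sgt lact_push.
(* Both sides become pushforwards along the single map [Psi]; by [u_theta], acting by [(s, t)]
   outside amounts to translating by [(b^-1, b'^-1)] inside. *)
pose Psi (f : Gam * Gam) : G * G := (u f.1 (theta (s * g)%g x), u f.2 (theta t x)).
rewrite [X in l1le _ X](_ : _ = push F Psi (m (b^-1 * c * b')%g)); last first.
  apply: eq_push => f fF; rewrite /kernel_map sgt.
  by have [-> _] := not_truncated fF tsgx; have [_ ->] := not_truncated fF ttx.
rewrite [X in l1le X _](_ : _ =
    push F (fun f => Psi ((b^-1, b'^-1)%g * f)%g) (m c)).
  rewrite -push_lact; apply: push_l1le me => //.
  exact: fprob_act.
apply: eq_push => f fF; rewrite /kernel_map /Psi.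
have [-> _] := not_truncated fF tgx; have [_ ->] := not_truncated fF tx.
rewrite /= !u_theta// alpha_sg -/b'.
by rewrite -[(alpha g x * b * _)%g]mulgA !mulVKg -mulgA.
Qed.

Definition averaged g p : R := mean P (fun x => kernel g x p).

Lemma averaged_fprob g : fprob kernel_supp (averaged g).
Proof.
have mk := kernel_bounded_measurable g.
split.
- move=> p; rewrite -(mean_cst P1 0); apply: le_mean => //.
    exact: bounded_measurable_cst.
  by move=> x; case: (kernel_fprob g x).
- move=> p pF; rewrite -(mean_cst P1 0); congr mean; apply/funext => x.
  by case: (kernel_fprob g x) => _ ->.
- rewrite -mean_sum// -(mean_cst P1 1); congr mean; apply/funext => x.
  by case: (kernel_fprob g x).
Qed.

(** The integrated distance is at most [e] off the bad sets and at most 2 on them; with [n] bad sets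
    of measure at most [e] this gives [e + 2 * n * e]. *)
Lemma averaged_equivariant g s t (e : R) (bad : seq (set T)) : 0 <= e ->
  (forall B, B \in bad -> measurable B /\ pr P B <= e) ->
  (forall x, (forall B, B \in bad -> ~ B x) ->
    l1le (lact (s, t) (kernel g x)) (kernel (s * g * t^-1)%g (theta t x)) e) ->
  l1le (lact (s, t) (averaged g)) (averaged (s * g * t^-1)%g)
    ((size bad).*2.+1%:R * e).
Proof.
move=> e0 mbad kbad l ul.
pose k1 p x := lact (s, t) (kernel g x) p.
pose k2 p x := kernel (s * g * t^-1)%g (theta t x) p.
have mk1 p : bounded_measurable (k1 p) by exact: kernel_bounded_measurable.
have mk2 p : bounded_measurable (k2 p).
  exact: (bounded_measurable_comp (mtheta t)
    (kernel_bounded_measurable (s * g * t^-1)%g p)).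
have mkB p : bounded_measurable (fun x => k1 p x - k2 p x).
  exact: bounded_measurableB.
have mkN p : bounded_measurable (fun x => `|k1 p x - k2 p x|).
  exact: bounded_measurable_norm.
have mind B : B \in bad -> bounded_measurable (\1_B : T -> R).
  by move=> /mbad[mB _]; exact: bounded_measurable_indic.
have msum : bounded_measurable (fun x => \sum_(B <- bad) (\1_B x : R)).
  exact: bounded_measurable_sum.
have m2sum : bounded_measurable (fun x => 2 * \sum_(B <- bad) (\1_B x : R)).
  by apply: bounded_measurableM => //; exact: bounded_measurable_cst.
have mbound : bounded_measurable (fun x => e + 2 * \sum_(B <- bad) (\1_B x : R)).
  by apply: bounded_measurableD => //; exact: bounded_measurable_cst.
(* As [theta t] preserves [P], the second average may be taken at [theta t x] instead of [x]. *)
apply: (@le_trans _ _ (\sum_(p <- l) mean P (fun x => `|k1 p x - k2 p x|))).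
  apply: ler_sum => p _; apply: le_trans (mean_norm P1 (mkB p)).
  rewrite meanB// /averaged -(mean_comp P1 (mtheta t) (Ptheta t)
    (kernel_bounded_measurable (s * g * t^-1)%g p)).
  by [].
rewrite -mean_sum//.
apply: (@le_trans _ _ (mean P (fun x => e + 2 * \sum_(B <- bad) \1_B x))).
  apply: le_mean => //; first exact: bounded_measurable_sum.
  move=> x; have sum0 (r : seq (set T)) : 0 <= \sum_(B <- r) (\1_B x : R).
    by apply: sumr_ge0 => B _; rewrite indicE.
  have [[B Bbad Bx]|nbad] := pselect (exists2 B, B \in bad & B x); last first.
    apply: (@le_trans _ _ e); last by rewrite lerDl mulr_ge0.
    by apply: kbad => // B Bbad Bx; apply: nbad; exists B.
  apply: (@le_trans _ _ 2).
    by apply: Prob_l1le2 => //; [apply: Prob_act|]; exact: fprob_Prob (kernel_fprob _ _).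
  rewrite ler_wpDl// ler_peMr// (big_rem B)//= indicE mem_set//.
  by rewrite lerDl.
rewrite meanD//; last exact: bounded_measurable_cst.
rewrite mean_cst// meanZ// mean_sum//.
have sum_le : \sum_(B <- bad) mean P (\1_B) <= (size bad)%:R * e.
  rewrite mulr_natl -(count_predT bad) -iter_addr_0 -big_const_seq.
  rewrite big_seq [leRHS]big_seq; apply: ler_sum => B /mbad[mB Be].
  by rewrite mean_indic.
rewrite (_ : (size bad).*2.+1%:R = 2 * (size bad)%:R + 1).
  by lra.
by rewrite -natrM natr1 mul2n.
Qed.

End Kernel.

Lemma cocycle_transfer : approx_equivariant R Gam -> approx_equivariant R G.
Proof.
(* Eight bad sets are used below, and [averaged_equivariant] costs the factor [2 * 8 + 1 = 17]. *)
move=> aGam E e e0; pose eta := e / 17.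
have eta0 : 0 < eta by rewrite divr_gt0.
pose S := [seq f.1 | f <- E] ++ [seq f.2 | f <- E].
(* Up to measure [eta], the cocycle at the finitely many elements occurring in [E] takes values in a
   finite list [B]; [E'] then holds the pairs for which [m] must be equivariant. *)
have [B Beta] := pr_tight_seq P1 S countGam malpha eta0.
set TA := [set x | _] in Beta.
have mTA : measurable TA by exact: measurable_exists_notin.
pose E' : seq (Gam * Gam) := [seq (b^-1, b'^-1)%g | b <- B, b' <- B].
have [F [m [Fm m_equi]]] := aGam E' eta eta0.
have finK : finite_set (\bigcup_(s in [set` E'])
    [set c | ~ l1le (lact s (m c)) (m (s.1 * c * s.2^-1)%g) eta]).
  by apply: bigcup_finite => [|s /m_equi//]; exact: finite_seq.
have /finite_seqP[K KE] := finK.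
pose L := [seq f.1 | f <- F] ++ [seq f.2 | f <- F].
have [D Deta] := pr_tight_seq P1 L countG mu eta0.
have mtrunc : measurable (truncated F D) by exact: measurable_exists_notin.
exists (kernel_supp D), (averaged F m D); split; first exact: averaged_fprob.
(* The kernel evaluates [m] at [(alpha g x)^-1], so the inverses of the exceptional points [K] of
   [m] must be avoided; [cocycle_proper] does this for all but finitely many [g]. *)
move=> [s t] stE; have := cocycle_proper [seq c^-1%g | c <- K] eta0.
apply: sub_finite_set => g /= ng Keta; apply: ng.
set KA := [set x | _] in Keta.
have mKA : measurable KA.
  exact: (level_measurable_preimage countGam (malpha g)
    [set k | k \in [seq c^-1%g | c <- K]]).
have [sS tS] : s \in S /\ t \in S.
  by split; rewrite mem_cat; apply/orP; [left|right]; apply/mapP; exists (s, t).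
(* Off these sets [x] is in [X], [alpha t x] and [alpha s (theta g x)] are in [B], [m] is evaluated
   away from [K], and none of the four points in [kernel_equivariant] is truncated. *)
pose bad := [:: ~` X; TA; theta g @^-1` TA; KA; truncated F D;
  theta g @^-1` truncated F D; theta t @^-1` truncated F D;
  theta (s * g)%g @^-1` truncated F D].
rewrite (_ : e = (size bad).*2.+1%:R * eta); last first.
  by rewrite /eta mulrC divfK.
apply: averaged_equivariant => //; first exact: ltW.
  have pre h A : measurable A -> pr P A <= eta ->
      measurable (theta h @^-1` A) /\ pr P (theta h @^-1` A) <= eta.
    by move=> mA Ae; rewrite pr_theta//; split => //; exact: mtheta_preimage.
  move=> A; rewrite !inE.
  move=> /predU1P[->|]; first by rewrite prXC ltW//; split => //; exact: measurableC.
  move=> /predU1P[->//|/predU1P[->|/predU1P[->//|/predU1P[->//|]]]]; first exact: pre.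
  by move=> /predU1P[->|/predU1P[->|/eqP->]]; exact: pre.
move=> x nbad.
have {}nbad A : A \in bad -> ~ A x by exact: nbad.
have Xx : X x by apply: contrapT; apply: (nbad (~` X)); rewrite !inE eqxx.
have memB h y : h \in S -> ~ TA y -> alpha h y \in B.
  by move=> hS; apply: contra_notT => hB; exists h.
apply: kernel_equivariant => //.
- by apply: (nbad (truncated F D)); rewrite !inE eqxx ?orbT.
- by apply: (nbad (theta g @^-1` truncated F D)); rewrite !inE eqxx ?orbT.
- by apply: (nbad (theta t @^-1` truncated F D)); rewrite !inE eqxx ?orbT.
- by apply: (nbad (theta (s * g)%g @^-1` truncated F D)); rewrite !inE eqxx ?orbT.
move=> /=; set b := alpha s _; set b' := alpha t x; set c := (alpha g x)^-1%g.
have bB : b \in B.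
  by apply: memB => //; apply: (nbad (theta g @^-1` TA)); rewrite !inE eqxx ?orbT.
have b'B : b' \in B by apply: memB => //; apply: (nbad TA); rewrite !inE eqxx ?orbT.
have cK : c \notin K.
  apply/negP => cK; apply: (nbad KA); first by rewrite !inE eqxx ?orbT.
  by apply/mapP; exists c; rewrite ?invgK.
apply: contrapT => nl1; move/negP: cK; apply.
have : [set` K] c; last by [].
rewrite -KE; exists (b^-1, b'^-1)%g; last by rewrite /= invgK.
by apply/allpairsP; exists (b, b').
Qed.

End CocycleTransfer.

(** * Tilings of a coupling *)

Section Tilings.
Context d (T : measurableType d) (R : realType) (nu : {measure set T -> \bar R}).

Lemma countable_negligible_bigcup (I : Type) (F : I -> set T) :
  countable [set: I] -> (forall i, nu.-negligible (F i)) ->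
  nu.-negligible (\bigcup_i F i).
Proof.
elim/Ppointed: I => I in F *; first by move=> *; rewrite empty_eq0 bigcup0//; exact: negligible_set0.
move=> /countable_bijP[B] /ppcard_eqP[f] Fm.
rewrite (reindex_bigcup f^-1%FUN setT)//=; last exact: (@subl_surj _ _ B).
exact: negligible_bigcup.
Qed.

(** Both sets are cut into countably many levels whose measures agree one by one; sigma-additivity
    adds them up. *)
Lemma eq_measure_levels (K : choiceType) (A B : set T) (h1 h2 : T -> K) :
  countable [set: K] -> measurable A -> measurable B ->
  level_measurable h1 -> level_measurable h2 ->
  (forall k, nu (A `&` h1 @^-1` [set k]) = nu (B `&` h2 @^-1` [set k])) ->
  nu A = nu B.
Proof.
move=> cK mA mB mh1 mh2 h12; have /countable_injP[n ninj] := cK.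
have nuE (C : set T) (h : T -> K) : measurable C -> level_measurable h ->
    nu C = (\sum_(i <oo) nu (C `&` (n \o h) @^-1` [set i]))%E.
  move=> mC mh.
  have mlev i : measurable (C `&` (n \o h) @^-1` [set i]).
    by apply: measurableI => //; rewrite comp_preimage; exact: level_measurable_preimage.
  have CE : \bigcup_i (C `&` (n \o h) @^-1` [set i]) = C.
    by apply/seteqP; split => [x [i _ []//]|x Cx]; exists (n (h x)).
  rewrite -[in LHS]CE measure_semi_bigcup ?CE//.
  by move=> i j _ _ [x [[_ <-] [_ <-]]].
rewrite (nuE A h1)// (nuE B h2)//; congr (limn _); apply/funext => N.
apply: eq_bigr => i _.
(* Levels are indexed by natural numbers; an index outside the image of [n] has an empty level on
   both sides. *)
have [[k nk]|nok] := pselect (exists k, n k = i).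
  have nE (h : T -> K) : (n \o h) @^-1` [set i] = h @^-1` [set k].
    apply/seteqP; split => x /= nx; last by rewrite nx.
    by apply: ninj; rewrite ?in_setT// nx nk.
  by rewrite !nE h12.
have n0 (h : T -> K) : (n \o h) @^-1` [set i] = set0.
  by rewrite -subset0 => x nx; apply: nok; exists (h x).
by rewrite !n0 !setI0.
Qed.

Lemma action_image (L : groupType) (act : L -> T -> T) (s : L) (A : set T) :
  is_action act -> act s @` A = act s^-1%g @^-1` A.
Proof.
move=> [act1 actM]; apply/seteqP; split => [_ [x Ax <-]|x /= Ax].
  by rewrite /= -actM mulVg act1.
by exists (act s^-1%g x) => //; rewrite -actM mulgV act1.
Qed.

(* [c x] records the translate of the tile in which [x] lies. *)
Lemma tiling_map (L : groupType) (act : L -> T -> T) (X Z : set T) :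
  is_action act -> (forall s, measurable_fun setT (act s)) ->
  measurable X -> measurable Z ->
  (forall s x, Z x -> Z (act s x)) ->
  (forall x, Z x -> exists s, (act s @` X) x) ->
  (forall x s t, Z x -> (act s @` X) x -> (act t @` X) x -> s = t) ->
  exists c : T -> L, [/\ level_measurable c,
    forall s x, Z x -> c (act s x) = (s * c x)%g
    & forall x, Z x -> c x = 1%g -> X x].
Proof.
move=> actA mact mX mZ Zact Zex Zuniq.
have [act1 actM] := actA.
(* The default value 1 off [Z] puts the complement of [Z] into level 1. *)
pose c x := if x \in Z then xget 1%g [set s | (act s @` X) x] else 1%g.
have cP x : Z x -> (act (c x) @` X) x.
  move=> Zx; rewrite /c mem_set//; case: xgetP => [s _ //|nos].
  by have [s /nos] := Zex x Zx.
exists c; split.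
- move=> s; rewrite (_ : _ @^-1` _ =
      (Z `&` act s^-1%g @^-1` X) `|` (if s == 1%g then ~` Z else set0)).
    apply: measurableU; last by case: ifP => // _; exact: measurableC.
    by apply: measurableI => //; rewrite -[_ @^-1` _]setTI; exact: mact.
  apply/seteqP; split => x /=.
    have [Zx <-|nZx] := pselect (Z x).
      by left; split => //; have := cP x Zx; rewrite action_image.
    by rewrite /c memNset// => <-; right; rewrite eqxx.
  move=> [[Zx]|].
    rewrite -[X (act _ x)]/((act s^-1%g @^-1` X) x) -action_image// => sX.
    exact: Zuniq (cP x Zx) sX.
  by case: eqP => // -> nZx; rewrite /c memNset.
- move=> s x Zx; apply: (Zuniq (act s x)) => //; [exact: Zact|exact: cP (Zact s x Zx)|].
  have [y Xy yx] := cP x Zx; exists y => //.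
  by rewrite actM yx.
- by move=> x Zx cx; have := cP x Zx; rewrite cx => -[y Xy]; rewrite act1 => <-.
Qed.

(** Remove all translates of a measurable null set containing [N]: there are countably many and each
    is null, and their union is invariant. *)
Lemma invariant_conull (L : groupType) (act : L -> T -> T) (N : set T) :
  countable [set: L] -> is_action act -> (forall s, measurable_fun setT (act s)) ->
  (forall s A, measurable A -> nu (act s @^-1` A) = nu A) ->
  nu.-negligible N ->
  exists Z, [/\ measurable Z, nu (~` Z) = 0%E, forall x, Z x -> ~ N x
    & forall s x, Z x -> Z (act s x)].
Proof.
move=> cL [act1 actM] mact nuact [B [mB B0 NB]].
pose W := \bigcup_s (act s @^-1` B).
have mactB s : measurable (act s @^-1` B).
  by rewrite -[_ @^-1` _]setTI; exact: mact.
have mW : measurable W by exact: countable_bigcupT_measurable.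
exists (~` W); split.
- exact: measurableC.
- rewrite setCK; apply/negligibleP => //; apply: countable_negligible_bigcup => // s.
  by apply/negligibleP => //; rewrite -B0 -(nuact s B mB).
- by move=> x nW /NB Bx; apply: nW; exists 1%g => //=; rewrite act1.
- by move=> s x nW [t _ /= tsx]; apply: nW; exists (t * s)%g => //=; rewrite actM.
Qed.

Definition tiling_defect (L : groupType) (act : L -> T -> T) (X : set T) : set T :=
  (~` \bigcup_s (act s @` X)) `|`
  \bigcup_(st : L * L) [set x | st.1 <> st.2 /\ (act st.1 @` X `&` act st.2 @` X) x].

Lemma tiling_defect_negligible (L : groupType) (act : L -> T -> T) (X : set T) :
  countable [set: L] -> ae_tiling nu act X -> nu.-negligible (tiling_defect act X).
Proof.
move=> cL [negC negI]; rewrite /tiling_defect.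
apply: (negligibleU negC).
apply: countable_negligible_bigcup.
  by rewrite -setXTT; exact: countableX.
move=> [s t]; have [->|/eqP st] := eqVneq s t.
  rewrite (_ : [set _ | _] = set0); first exact: negligible_set0.
  by rewrite -subset0 => x [].
by apply: negligibleS (negI s t st) => x [].
Qed.

End Tilings.

(** * The cocycle of a measure equivalence coupling *)

Section Coupling.
Context d (T : measurableType d) (R : realType) (nu : {measure set T -> \bar R}).
Variables (G Gam : groupType) (act : G * Gam -> T -> T).
Hypotheses (countG : countable [set: G]) (countGam : countable [set: Gam]).
Hypotheses (actA : is_action act) (mact : forall s, measurable_fun setT (act s))
  (nuact : forall s A, measurable A -> nu (act s @^-1` A) = nu A).
Variables (X Y : set T).
Hypotheses (mX : measurable X) (X_fin : (nu X < +oo)%E) (mY : measurable Y).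
Hypotheses (tileX : ae_tiling nu (fun c => act (1%g, c)) X)
  (tileY : ae_tiling nu (fun g => act (g, 1%g)) Y).
Hypothesis nuT : nu [set: T] != 0%E.

Let mpre s A : measurable A -> measurable (act s @^-1` A).
Proof. by move=> mA; rewrite -[_ @^-1` _]setTI; exact: mact. Qed.

Let actGam : is_action (fun c => act (1%g, c)).
Proof.
have [act1 actM] := actA; split => [x|c c' x]; first exact: act1.
by rewrite -actM; congr (act (_, _) x); rewrite mulg1.
Qed.

Let actG : is_action (fun g => act (g, 1%g)).
Proof.
have [act1 actM] := actA; split => [x|c c' x]; first exact: act1.
by rewrite -actM; congr (act (_, _) x); rewrite mulg1.
Qed.

Let act_comp g c g' c' x : act (g, c) (act (g', c') x) = act (g * g', c * c')%g x.
Proof. by have [_ actM] := actA; rewrite -actM. Qed.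

Let count_prod : countable [set: G * Gam].
Proof. by rewrite -setXTT; exact: countableX. Qed.

(** Both tilings fail only on a null set; removing it invariantly under [G * Gam] leaves one [Z] on
    which both are exact, and [tiling_map] applies to each. *)
Lemma coupling_maps : exists (Z : set T) (c : T -> Gam) (h : T -> G),
  [/\ measurable Z /\ nu (~` Z) = 0%E,
      forall s x, Z x -> Z (act s x),
      level_measurable c /\ level_measurable h,
      (forall k x, Z x -> c (act (1%g, k) x) = (k * c x)%g) /\
      (forall x, Z x -> c x = 1%g -> X x)
    & forall g x, Z x -> h (act (g, 1%g) x) = (g * h x)%g].
Proof.
have neg := negligibleU (tiling_defect_negligible countGam tileX)
  (tiling_defect_negligible countG tileY).
have [Z [mZ Z0 Zn Zact]] := invariant_conull count_prod actA mact nuact neg.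
have tile (L : groupType) (a : L -> T -> T) (W : set T) :
    (forall x, Z x -> ~ tiling_defect a W x) ->
    (forall x, Z x -> exists s, (a s @` W) x) /\
    (forall x s t, Z x -> (a s @` W) x -> (a t @` W) x -> s = t).
  move=> Zd; split => [x /Zd nx|x s t /Zd nx sx tx].
    apply: contrapT => ns; apply: nx; left => -[s _ sx].
    by apply: ns; exists s.
  by apply: contrapT => st; apply: nx; right; exists (s, t).
have [exX uniqX] := tile _ (fun c => act (1%g, c)) X (fun x Zx H => Zn x Zx (or_introl H)).
have [exY uniqY] := tile _ (fun g => act (g, 1%g)) Y (fun x Zx H => Zn x Zx (or_intror H)).
have [c [mc cact cX]] := tiling_map actGam (fun s => mact _) mX mZ
  (fun s x => Zact _ x) exX uniqX.
have [h [mh hact _]] := tiling_map actG (fun s => mact _) mY mZ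
  (fun s x => Zact _ x) exY uniqY.
by exists Z, c, h; split.
Qed.

Lemma coupling_transfer : approx_equivariant R Gam -> approx_equivariant R G.
Proof.
have [act1 actM] := actA.
have [Z [c [h [[mZ Z0] Zact [mc mh] [cact cX] hact]]]] := coupling_maps.
(* This subset of [X] lies in [Z], so the identities hold on it at every point. *)
pose X' := Z `&` c @^-1` [set 1%g].
have mX' : measurable X' by apply: measurableI => //; exact: mc.
have X'_fin : (nu X' < +oo)%E.
  by apply: le_lt_trans X_fin; apply: le_measure; rewrite ?inE// => x [Zx /cX]; exact.
have ZactE s x : Z (act s x) -> Z x.
  by move=> /(Zact s^-1%g); rewrite -actM mulVg act1.
(* The [Gam]-translates of [X'] cover [Z]; were [X'] null, the whole space would be null. *)
have X'_gt0 : (0 < nu X')%E.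
  rewrite lt0e measure_ge0 andbT; apply/eqP => X'0.
  have Znull : nu.-negligible Z.
    apply: (@negligibleS _ _ _ _ (\bigcup_(k : Gam) (act (1%g, k) @^-1` X'))).
      move=> x Zx; exists (c x)^-1%g => //; split; first exact: Zact.
      by rewrite /= cact// mulVg.
    apply: countable_negligible_bigcup => // k.
    by apply/negligibleP; [exact: mpre|exact: etrans (nuact _ mX') X'0].
  have /negligibleP : nu.-negligible (Z `|` ~` Z).
    by apply: negligibleU => //; apply/negligibleP => //; exact: measurableC.
  by rewrite setUv => /(_ measurableT) /eqP; rewrite (negbTE nuT).
have X'_num : nu X' \is a fin_num by rewrite ge0_fin_numE.
have r0 : 0 <= (fine (nu X'))^-1 by rewrite invr_ge0 fine_ge0.
(* The normalised restriction of [nu] to [X'], kept as a measure on all of [T]. *)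
pose P : {measure set T -> \bar R} := mscale (NngNum r0) (mrestr nu mX').
have PE A : P A = ((fine (nu X'))^-1%:E * nu (A `&` X'))%E by [].
pose alpha (g : G) (x : T) : Gam := c (act (g, 1%g) x).
pose theta (g : G) (x : T) : T := act (g, (alpha g x)^-1)%g x.
pose u (k : Gam) (x : T) : G := h (act (1%g, k^-1%g) x).
have malpha g : level_measurable (alpha g) by move=> k; exact: mpre (mc k).
(* On each of the countably many levels of [alpha g], [theta g] is the action of one fixed
   element. *)
have mtheta g : measurable_fun setT (theta g).
  move=> _ A mA; rewrite setTI (_ : _ @^-1` _ =
      \bigcup_(k : Gam) (alpha g @^-1` [set k] `&` act (g, k^-1)%g @^-1` A)).
    apply: countable_bigcupT_measurable => // k.
    by apply: measurableI; [exact: malpha|exact: mpre].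
  apply/seteqP; split => x.
    by move=> Ax; exists (alpha g x).
  by move=> [k _ [/= <-]].
have alphaM g g' x : X' x -> alpha (g * g')%g x = (alpha g' x * alpha g (theta g' x))%g.
  move=> [Zx _]; rewrite [alpha g (theta g' x)]/alpha.
  have -> : act (g, 1)%g (theta g' x) = act (1, (alpha g' x)^-1)%g (act (g * g', 1)%g x).
    by rewrite /theta !act_comp !mul1g !mulg1.
  by rewrite cact ?mulVKg//; exact: Zact.
apply: (@cocycle_transfer _ _ _ P _ _ X' theta alpha u) => //.
- by rewrite PE setTI -[X in (_ * X)%E]fineK// -EFinM mulVf// gt_eqF// fine_gt0//;
    apply/andP.
- by rewrite PE setICl measure0 mule0.
- move=> g A mA; rewrite !PE; congr (_ * _)%E.
  have mtA : measurable (theta g @^-1` A) by rewrite -[_ @^-1` _]setTI; exact: mtheta.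
  (* On the level [alpha g x = k], [theta g] is the action of [(g, k^-1)]. A point [y] of [X'] comes
     from that level of [X'] exactly when [c] takes the value [k^-1] at [g^-1 y], so invariance of
     [nu] matches the levels. *)
  have minv : level_measurable (fun y => (c (act (g^-1, 1)%g y))^-1%g).
    move=> k; rewrite (_ : _ @^-1` _ = alpha g^-1%g @^-1` [set k^-1%g]); first exact: malpha.
    apply/seteqP; split => y /=; first by move=> <-; rewrite invgK.
    by rewrite /alpha => ->; rewrite invgK.
  have mA1 := measurableI _ _ mtA mX'; have mA2 := measurableI _ _ mA mX'.
  apply: (eq_measure_levels countGam mA1 mA2 (malpha g) minv) => k.
  rewrite -[RHS](nuact (g, k^-1)%g); last by apply: measurableI => //; exact: minv.
  congr (nu _); apply/seteqP; split => x.
    move=> [[/= tA [Zx cx]] ax]; split; first split => /=.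
    + by move: tA; rewrite /theta ax.
    + split; first exact: Zact.
      have -> : act (g, k^-1)%g x = act (1, k^-1)%g (act (g, 1)%g x).
        by rewrite act_comp mul1g mulg1.
      by rewrite /= cact; [rewrite -/(alpha g x) ax mulVg|exact: Zact].
    + rewrite /= act_comp mulVg mul1g cact// cx mulg1 invgK//.
  move=> [[/= Ax [Zx cx]] ax].
  have {}Zx := ZactE _ _ Zx.
  have cx1 : c x = 1%g.
    move: ax; rewrite act_comp mulVg mul1g cact// => /(congr1 (fun z => z^-1)%g).
    by rewrite invgK => /(congr1 (fun z => k * z)%g); rewrite mulVKg mulgV.
  have ag : alpha g x = k.
    move: cx; have -> : act (g, k^-1)%g x = act (1, k^-1)%g (act (g, 1)%g x).
      by rewrite act_comp mul1g mulg1.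
    rewrite /= cact; last exact: Zact.
    by move=> /(congr1 (fun z => k * z)%g); rewrite mulVKg mulg1.
  by split => //; split => //=; rewrite /theta ag.
- by move=> k a; exact: mpre (mh a).
- move=> g g' x X'x; rewrite [theta g (theta g' x)]/theta /theta act_comp -invgM.
  by rewrite -/(theta g' x) -alphaM.
- move=> k g x [Zx _].
  (* The actions commute, so [g] can be moved outermost, where [h] is equivariant. *)
  have E : act (1, k^-1)%g (theta g x) = act (g, 1)%g (act (1, (alpha g x * k)^-1)%g x).
    by rewrite /theta !act_comp !mul1g !mulg1 invgM.
  by rewrite /u E hact//; exact: Zact.
Qed.

End Coupling.

Theorem theorem1p2 (R : realType) (G Gam : groupType)
  (countG : countable [set: G]) (countGam : countable [set: Gam]) :
  measure_equivalent R G Gam -> classS R Gam -> classS R G.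
Proof.
move=> [d [T [nu [act [X [Y [[_ _ nuT] [actA mact nuact] [mX X_fin tileX] [mY _ tileY]]]]]]]].
move=> /classS_approx_equivariant aGam; apply: approx_equivariant_classS.
exact: (coupling_transfer countG countGam actA mact nuact mX X_fin mY tileX tileY nuT).
Qed.
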